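(* Let $L$ be a knot or link in $S^3$. For a braid $\beta$ whose closure is $L$, let $c_\beta$ be the number of crossings in $\beta$ and $s_\beta$ the number of strings of $\beta$. Then $L$ has a triple crossing projection with no more than $c_\beta - s_\beta + 1$ triple crossings, for every braid $\beta$ (braid word) whose closure is $L$; in particular the quantity $c_\beta - s_\beta + 1$ can be minimized over all braid representations $\beta$ of $L$.
   Context: A triple crossing in a projection of a knot or link is a singular point of the projection at which exactly three strands of the knot or link cross, each passing straight through the crossing; one strand is on top (T), one is in the middle (M), one is on the bottom (B). A triple crossing projection of $L$ is a projection of $L$ whose only singular points are triple crossings. A braid representation of $L$ is a braid (given by a braid diagram, i.e. a word in the standard generators and their inverses) whose standard closure is $L$; its number of crossings is the number of (ordinary, double) crossings in the diagram.
   Formalization: Braid words, also in the minimization, are required to contain every standard generator (connected closed diagram; automatic for knots and non-split links): otherwise the claim fails, e.g. the trivial 2-string braid would give −1 triple crossings. *)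

(* Defs.v *)
From mathcomp Require Import all_boot all_order all_algebra.
From mathcomp Require Import boolp classical_sets cardinality reals.
From Stdlib Require Import Relation_Operators.

Set Implicit Arguments.
Unset Strict Implicit.
Unset Printing Implicit Defensive.

Import Order.TTheory GRing.Theory Num.Theory.

Local Open Scope classical_set_scope.
Local Open Scope ring_scope.

Definition edge (R : realType) : Type := ('rV[R]_3 * 'rV[R]_3)%type.

Definition seg (R : realType) (a b : 'rV[R]_3) : set 'rV[R]_3 :=
  [set x | exists t : R, [/\ 0 <= t, t <= 1 & x = (1 - t) *: a + t *: b]].

Definition open_seg (R : realType) (a b : 'rV[R]_3) : set 'rV[R]_3 :=
  [set x | exists t : R, [/\ 0 < t, t < 1 & x = (1 - t) *: a + t *: b]].

Definition triangle (R : realType) (a b c : 'rV[R]_3) : set 'rV[R]_3 :=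
  [set x | exists r s t : R, [/\ 0 <= r, 0 <= s, 0 <= t, r + s + t = 1 &
                                 x = r *: a + s *: b + t *: c]].

Definition body (R : realType) (K : seq (edge R)) : set 'rV[R]_3 :=
  [set x | exists2 e, e \in K & seg e.1 e.2 x].

(* K lists the edges of finitely many pairwise disjoint simple closed polygons
   in 3-space, each oriented so that every vertex is the first endpoint of
   exactly one edge and the second endpoint of exactly one edge. *)
Definition link_edges (R : realType) (K : seq (edge R)) : Prop :=
  [/\ K <> [::],
      forall e, e \in K -> e.1 != e.2,
      uniq (unzip1 K),
      perm_eq (unzip1 K) (unzip2 K) &
      forall e f, e \in K -> f \in K -> e != f ->
        forall x, seg e.1 e.2 x -> seg f.1 f.2 x ->
          (x = e.2 /\ x = f.1) \/ (x = e.1 /\ x = f.2)].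

(* A (tame) knot or link, as an unoriented point set.  A link in S^3 is placed
   in R^3 by removing a point of its complement; this does not affect link
   types. *)
Definition polygonal_link (R : realType) (L : set 'rV[R]_3) : Prop :=
  exists2 K, link_edges K & L = body K.

(* Reidemeister's elementary deformation: ab, a straight piece of A, is replaced
   by ac and cb across a nondegenerate triangle that meets A only in ab.
   Since links are point sets, no separate subdivision move is needed. *)
Definition delta_move (R : realType) (A B : set 'rV[R]_3) : Prop :=
  exists a b c : 'rV[R]_3,
    [/\ row_free (col_mx (b - a) (c - a)),
        triangle a b c `&` A = seg a b &
        B = (A `\` seg a b) `|` seg a c `|` seg c b].

(* Combinatorial equivalence; on polygonal links it is ambient isotopy. *)
Definition link_equiv (R : realType) : set 'rV[R]_3 -> set 'rV[R]_3 -> Prop :=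
  clos_refl_sym_trans _ (@delta_move R).

Definition proj (R : realType) (p : 'rV[R]_(2 + 1)) : 'rV[R]_2 := lsubmx p.

Definition singular_points (R : realType) (K : seq (edge R)) : set 'rV[R]_2 :=
  [set q | exists x y, [/\ body K x, body K y, x != y, proj x = q &
                           proj y = q]].

(* Exactly three points of the link lie over q; each is interior to an edge,
   and the three projected edges pairwise cross transversally.  The top, middle
   and bottom strands are ordered by the third coordinate. *)
Definition triple_crossing (R : realType) (K : seq (edge R))
    (q : 'rV[R]_2) : Prop :=
  exists (e : 'I_3 -> edge R) (p : 'I_3 -> 'rV[R]_3),
    [/\ forall i, e i \in K,
        forall i, open_seg (e i).1 (e i).2 (p i),
        injective p,
        body K `&` (@proj R @^-1` [set q]) = range p &
        forall i j, i != j ->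
          row_free (col_mx (proj ((e i).2 - (e i).1))
                           (proj ((e j).2 - (e j).1)))].

Definition triple_crossing_projection (R : realType) (K : seq (edge R)) : Prop :=
  forall q, singular_points K q -> triple_crossing K q.

Definition has_triple_crossing_projection (R : realType) (L : set 'rV[R]_3)
    (k : nat) : Prop :=
  exists K : seq (edge R),
    [/\ link_edges K, link_equiv L (body K), triple_crossing_projection K &
        (singular_points K #= `I_k)%card].

(* A braid word on n.+1 strings; the letter (i, true) is the i-th standard
   generator (i counted from 0) and (i, false) is its inverse. *)
Definition braid_word (n : nat) : Type := seq ('I_n * bool).

Definition pt (R : realType) (x y z : R) : 'rV[R]_3 :=
  \row_(j < 3) [:: x; y; z]`_j.

(* The slab k <= y <= k + 1 of the geometric braid: the strands run in the
   y-direction at x = 0, ..., n.  At a letter (i, b) the strand going from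
   position i to position i + 1 passes over (b = true) or under (b = false)
   the strand going from i + 1 to i, which stays in the plane z = 0. *)
Definition braid_slab (R : realType) (n k : nat) (l : 'I_n * bool) :
    seq (edge R) :=
  let i := nat_of_ord l.1 in
  let m := pt (i%:R + 2^-1) (k%:R + 2^-1) (if l.2 then 1 else -1) in
  [:: (pt i%:R k%:R 0, m); (m, pt i.+1%:R k.+1%:R 0);
      (pt i.+1%:R k%:R 0, pt i%:R k.+1%:R 0)] ++
  [seq (pt j%:R k%:R 0, pt j%:R k.+1%:R 0)
     | j <- iota 0 n.+1 & (j != i) && (j != i.+1)].

(* The arc joining the top end (j, c) of position j to its bottom end (j, 0),
   around the right of the braid in the plane z = 0; these arcs are nested. *)
Definition closing_arc (R : realType) (n c j : nat) : seq (edge R) :=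
  let d : R := (n.+1 - j)%:R in
  let x : R := j%:R in
  let x' : R := (n.*2.+1 - j)%:R in
  [:: (pt x c%:R 0, pt x (c%:R + d) 0);
      (pt x (c%:R + d) 0, pt x' (c%:R + d) 0);
      (pt x' (c%:R + d) 0, pt x' (- d) 0);
      (pt x' (- d) 0, pt x (- d) 0);
      (pt x (- d) 0, pt x 0 0)].

Definition closed_braid (R : realType) (n : nat) (w : braid_word n) :
    seq (edge R) :=
  flatten [seq braid_slab R kl.1 kl.2 | kl <- zip (iota 0 (size w)) w] ++
  flatten [seq closing_arc R n (size w) j | j <- iota 0 n.+1].

Definition is_closure (R : realType) (n : nat) (w : braid_word n)
    (L : set 'rV[R]_3) : Prop :=
  link_equiv (body (closed_braid R w)) L.

(* Every standard generator occurs in w, with either sign; equivalently, the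
   closed braid diagram is connected.  Otherwise the closure is a split link.
   For split closures the bound below can fail: the trivial braid on two
   strings would give -1. *)
Definition connected_word (n : nat) (w : braid_word n) : Prop :=
  forall i : 'I_n, i \in unzip1 w.

(* The number of crossings minus the number of strings plus one. *)
Definition braid_bound (n : nat) (w : braid_word n) : int :=
  (size w)%:Z - n.+1%:Z + 1.

Definition triple_crossings_at_most (R : realType) (L : set 'rV[R]_3)
    (m : int) : Prop :=
  exists2 k : nat, has_triple_crossing_projection L k & k%:Z <= m.

(* Main.v *)
Require Import Defs.
From mathcomp Require Import all_boot all_order all_algebra.
From mathcomp Require Import boolp classical_sets cardinality reals.
From mathcomp Require Import ring lra zify.
From Stdlib Require Import Relation_Operators.

(** The letters of column [i] of a closed braid diagram, those in which strands
    [i] and [i + 1] cross, lie on a circle around the axis that meets the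
    diagram in these crossings only: nothing else runs between the two
    positions.  At the first letter of the column, take the strand that goes
    from position [i] to [i + 1].  It passes over (or under) the other strand,
    so it may be lifted above (or below) everything else and pushed across the
    whole disk bounded by the circle.  It then arrives from below, turns
    backwards into the circle, follows it all the way round and leaves upwards
    from the other side, which it does without crossing the other strand of its
    letter.  That crossing is gone, and every other crossing of the column now
    has a third strand passing straight through it.  Doing this in all [n]
    columns of a braid on [n + 1] strings leaves one triple crossing for each
    of the remaining [c - n] letters, [c] being the length of the word.

    Here the circles are rectangles.  The isotopy is carried out by elementary
    deformations: [bend_peaked] moves the raised vertex of a strand off its
    crossing point, so that the crossing becomes interior to two edges, and
    [wrap_peaked] wraps the strand of a first letter.  All wrapped strands run
    at one of the two heights [2] and [-2], so wider circles have to be treated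
    before narrower ones: then the disk to be swept contains no strand at its
    height.  The result is [closed_braid_moved].

    To see that the final diagram is a link with only triple crossings, its
    edges are taken without their second endpoints.  By [cells_meet] the
    projections of two such half-open edges are disjoint except at the
    crossings.  Since every endpoint is the start of exactly one edge, this
    yields the disjointness required of a polygonal link
    ([final_link_edges]) and the list of singular points
    ([final_singular_points]) at the same time.  The minimum over all braids
    exists because [c - n] bounds a number of crossings and is hence never
    negative. *)

Set Implicit Arguments.
Unset Strict Implicit.
Unset Printing Implicit Defensive.

Import Order.TTheory GRing.Theory Num.Theory.

Local Open Scope classical_set_scope.
Local Open Scope ring_scope.

(** * Points, segments and elementary deformations in coordinates *)

Section Deformations.
Variable R : realType.
Implicit Types (x y z s t : R) (p q u v : 'rV[R]_3) (K : seq (edge R)).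

Lemma pt_surj p : exists x y z, p = pt x y z.
Proof.
exists (p 0 ord0), (p 0 (lift ord0 ord0)), (p 0 (lift ord0 (lift ord0 ord0))).
by apply/rowP => -[[|[|[|//]]] lt_i]; rewrite mxE /=; congr (p 0 _); exact: val_inj.
Qed.

Lemma pt_inj x y z x' y' z' :
  pt x y z = pt x' y' z' -> [/\ x = x', y = y' & z = z'].
Proof.
move=> /rowP e; split.
- by have := e ord0; rewrite !mxE.
- by have := e (lift ord0 ord0); rewrite !mxE.
- by have := e (lift ord0 (lift ord0 ord0)); rewrite !mxE.
Qed.

Lemma ptD x y z x' y' z' :
  pt x y z + pt x' y' z' = pt (x + x') (y + y') (z + z').
Proof. by apply/rowP => -[[|[|[|//]]] lt_i]; rewrite !mxE. Qed.

Lemma ptZ t x y z : t *: pt x y z = pt (t * x) (t * y) (t * z).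
Proof. by apply/rowP => -[[|[|[|//]]] lt_i]; rewrite !mxE. Qed.

Lemma ptB x y z x' y' z' :
  pt x y z - pt x' y' z' = pt (x - x') (y - y') (z - z').
Proof. by apply/rowP => -[[|[|[|//]]] lt_i]; rewrite !mxE. Qed.

Lemma pt0 : 0 = pt 0 0 0 :> 'rV[R]_3.
Proof. by apply/rowP => -[[|[|[|//]]] lt_i]; rewrite !mxE. Qed.

Lemma segE p q u :
  seg p q u <-> exists t, [/\ 0 <= t, t <= 1 & u = p + t *: (q - p)].
Proof.
by split=> -[t [t0 t1 ->]]; exists t; split=> //;
  apply/rowP => i; rewrite !mxE; ring.
Qed.

Lemma seg_pt a b c a' b' c' x y z :
  seg (pt a b c) (pt a' b' c') (pt x y z) <->
  exists t, [/\ 0 <= t, t <= 1, x = a + t * (a' - a), y = b + t * (b' - b) &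
                z = c + t * (c' - c)].
Proof.
rewrite segE; split=> [[t [t0 t1]]|[t [t0 t1 -> -> ->]]].
  by rewrite ptB ptZ ptD => /pt_inj[? ? ?]; exists t.
by exists t; split=> //; rewrite ptB ptZ ptD.
Qed.

Lemma segl p q : seg p q p.
Proof. by rewrite segE; exists 0; rewrite scale0r addr0. Qed.

Lemma segr p q : seg p q q.
Proof.
by rewrite segE; exists 1; split=> //; rewrite scale1r addrC subrK.
Qed.

Lemma triangleE p q u v : triangle p q u v ->
  exists s t, [/\ 0 <= s, 0 <= t, s + t <= 1 &
                  v = p + s *: (q - p) + t *: (u - p)].
Proof.
move=> [r [s [t [r0 s0 t0 rst ->]]]]; exists s, t; split=> //; first by lra.
have -> : r = 1 - s - t by lra.
by apply/rowP => i; rewrite !mxE; ring.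
Qed.

Lemma triangle_pt a b c a' b' c' a'' b'' c'' x y z :
  triangle (pt a b c) (pt a' b' c') (pt a'' b'' c'') (pt x y z) ->
  exists s t, [/\ 0 <= s, 0 <= t, s + t <= 1 &
    [/\ x = a + s * (a' - a) + t * (a'' - a),
        y = b + s * (b' - b) + t * (b'' - b) &
        z = c + s * (c' - c) + t * (c'' - c)]].
Proof.
move=> /triangleE[s [t [s0 t0 st]]]; rewrite !ptB !ptZ !ptD => /pt_inj[? ? ?].
by exists s, t.
Qed.

Definition independent u v := forall s t, s *: u + t *: v = 0 -> s = 0 /\ t = 0.

Lemma independent_free u v : independent u v -> row_free (col_mx u v).
Proof.
move=> uv; apply: inj_row_free => x.
rewrite -(hsubmxK x) mul_row_col (mx11_scalar (lsubmx x)) (mx11_scalar (rsubmx x)).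
rewrite !mul_scalar_mx => /uv[-> ->].
by rewrite -(hsubmxK 0) !raddf0.
Qed.

Lemma body_nil : body [::] = set0 :> set 'rV[R]_3.
Proof. by apply/predeqP => p; split=> // -[]. Qed.

Lemma body_cons p q K : body ((p, q) :: K) = seg p q `|` body K.
Proof.
apply/predeqP => u; split=> [[e]|].
  by rewrite inE => /orP[/eqP -> | eK] ue; [left | right; exists e].
case=> [ue|[e eK ue]]; first by exists (p, q); rewrite ?mem_head.
by exists e => //; rewrite inE eK orbT.
Qed.

Lemma body_cat K1 K2 : body (K1 ++ K2) = body K1 `|` body K2.
Proof.
apply/predeqP => u; split=> [[e]|].
  by rewrite mem_cat => /orP[eK|eK] ue; [left | right]; exists e.
by case=> -[e eK ue]; exists e; rewrite // mem_cat eK ?orbT.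
Qed.

Lemma body_eq_mem K1 K2 : K1 =i K2 -> body K1 = body K2.
Proof.
by move=> eqK; apply/predeqP => u; split=> -[e eK ue]; exists e => //;
  rewrite ?eqK // -eqK.
Qed.

Definition polyline (ps : seq 'rV[R]_3) : seq (edge R) := zip ps (behead ps).

Lemma link_equiv_trans (A B C : set 'rV[R]_3) :
  link_equiv A B -> link_equiv B C -> link_equiv A C.
Proof. exact: rst_trans. Qed.

Lemma link_equiv_sym (A B : set 'rV[R]_3) : link_equiv A B -> link_equiv B A.
Proof. exact: rst_sym. Qed.

(** A deformation of one edge, stated for the rest [S] of the link, so that only
    the intersection of [S] with the triangle has to be controlled. *)
Lemma detour (S : set 'rV[R]_3) p q u :
  independent (q - p) (u - p) ->
  (forall v, S v -> triangle p q u v -> v = p \/ v = q) ->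
  link_equiv (S `|` seg p q) (S `|` (seg p u `|` seg u q)).
Proof.
move=> ind clear; apply: rst_step; exists p, q, u; split.
- exact: independent_free.
- apply/predeqP => v; split=> [[vt [vS|//]]|vs].
    by case: (clear _ vS vt) => ->; [apply: segl | apply: segr].
  split; last by right.
  have [t [t0 t1 ->]] := vs; exists (1 - t), t, 0.
  by split; rewrite ?scale0r ?addr0 //; lra.
- apply/predeqP => v; split.
    case=> [vS|[vpu|vuq]]; [|by left; right|by right].
    have [vpq|vpq] := pselect (seg p q v); last by left; left; split=> //; left.
    have [t [t0 t1 vE]] := vpq.
    have : triangle p q u v.
      by exists (1 - t), t, 0; split; rewrite ?scale0r ?addr0 //; lra.
    move/(clear _ vS) => [] ->; [left; right; apply: segl | right; apply: segr].
  by case=> [[[[vS|//] _]|vpu]|vuq]; [left | right; left | right; right].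
Qed.

(** A detour around three sides of a parallelogram is two triangular detours,
    one on either side of a diagonal. *)
Lemma parallelogram_detour (S : set 'rV[R]_3) p q p' q' :
  p' - p = q' - q -> independent (q - p) (p' - p) ->
  (forall v s t, 0 <= s <= 1 -> 0 <= t <= 1 ->
     v = p + s *: (q - p) + t *: (p' - p) -> S v -> v = p \/ v = q) ->
  link_equiv (S `|` seg p q)
    (S `|` (seg p p' `|` seg p' q' `|` seg q' q)).
Proof.
have [u uE] : exists u, u = p' - p by exists (p' - p).
rewrite -uE => /esym qE ind clear.
have {uE} -> : p' = p + u by rewrite uE addrC subrK.
have {qE} -> : q' = q + u by rewrite -qE addrC subrK.
apply: link_equiv_trans (detour (u := q + u) _ _) _.
- move=> s t E.
  have /ind : (s + t) *: (q - p) + t *: u = 0.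
    by rewrite -E; apply/rowP => i; rewrite !mxE; ring.
  by move=> [? ?]; split; lra.
- move=> v vS /triangleE[s [t [s0 t0 st vE]]].
  have vE' : v = p + (s + t) *: (q - p) + t *: u.
    by rewrite vE; apply/rowP => i; rewrite !mxE; ring.
  by apply: (clear v (s + t) t); rewrite //; lra.
have := @detour (S `|` seg (q + u) q) p (q + u) (p + u).
set A := (X in _ -> _ -> link_equiv X _); set B := (X in _ -> _ -> link_equiv _ X).
have -> : A = S `|` (seg p (q + u) `|` seg (q + u) q).
  by apply/predeqP => v; rewrite /A /setU /mkset; tauto.
have -> : B = S `|` (seg p (p + u) `|` seg (p + u) (q + u) `|` seg (q + u) q).
  by apply/predeqP => v; rewrite /B /setU /mkset; tauto.
apply.
  move=> s t E.
  have /ind : s *: (q - p) + (s + t) *: u = 0.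
    by rewrite -E; apply/rowP => i; rewrite !mxE; ring.
  by move=> [? ?]; split; lra.
move=> v vS /triangleE[s [t [s0 t0 st vE]]].
have vE' : v = p + s *: (q - p) + (s + t) *: u.
  by rewrite vE; apply/rowP => i; rewrite !mxE; ring.
case: vS => [vS|/segE[r [r0 r1 vr]]].
  have s01 : 0 <= s <= 1 by lra.
  have t01 : 0 <= s + t <= 1 by lra.
  have [->|vq] := clear v _ _ s01 t01 vE' vS; first by left.
  have /ind : (s - 1) *: (q - p) + (s + t) *: u = 0.
    have : v - q = 0 by rewrite vq subrr.
    by rewrite vE' => <-; apply/rowP => i; rewrite !mxE; ring.
  by move=> [? ?]; exfalso; lra.
right.
have /ind[s1 rE] : (s - 1) *: (q - p) + (s + t + r - 1) *: u = 0.
  rewrite -[RHS](subrr v) {1}vE' vr; apply/rowP => i; rewrite !mxE; ring.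
have r00 : r = 0 by lra.
by rewrite vr r00 scale0r addr0.
Qed.

Lemma independent_pt x y z x' y' z' :
  (forall s t, s * x + t * x' = 0 -> s * y + t * y' = 0 ->
               s * z + t * z' = 0 -> s = 0 /\ t = 0) ->
  independent (pt x y z) (pt x' y' z').
Proof.
by move=> ind s t; rewrite !ptZ ptD pt0 => /pt_inj[]; apply: ind.
Qed.

Lemma seg_split p q u : seg p q u -> seg p q = seg p u `|` seg u q.
Proof.
move=> /segE[r [r0 r1 ->]]; apply/predeqP => v; split.
  move=> /segE[t [t0 t1 ->]]; case: (leP t r) => tr.
    have [rz|rz] := eqVneq r 0.
      have -> : t = r by lra.
      by left; apply: segr.
    left; apply/segE; exists (t / r); split.
    - by rewrite divr_ge0.
    - by rewrite ler_pdivrMr ?mul1r // lt_neqAle eq_sym rz.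
    - by apply/rowP => i; rewrite !mxE; field.
  right; apply/segE; have d0 : 0 < 1 - r by lra.
  exists ((t - r) / (1 - r)); split.
  - by rewrite divr_ge0 //; lra.
  - by rewrite ler_pdivrMr // mul1r; lra.
  - by apply/rowP => i; rewrite !mxE; field; rewrite lt0r_neq0.
case=> /segE[t [t0 t1 ->]]; apply/segE.
  exists (t * r); split; [exact: mulr_ge0 | by nra |].
  by apply/rowP => i; rewrite !mxE; ring.
exists (r + t * (1 - r)); split; [by nra | by nra |].
by apply/rowP => i; rewrite !mxE; ring.
Qed.

End Deformations.

(** * The wrapped diagram *)

Section Diagram.
Variables (R : realType) (n : nat) (w : braid_word n).

Local Notation c := (size w).

Definition cols : seq nat := [seq nat_of_ord l.1 | l <- w].

Definition col (k : nat) : nat := nth 0%N cols k.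

(** The height of the raised vertex in slab [k]; its sign tells on which side of
    the rest of the diagram the strand is wrapped. *)
Definition sg (k : nat) : R := if nth true (unzip2 w) k then 1 else -1.

(** The slab whose crossing disappears when column [i] is treated.  Taking the
    first one puts all other crossings of the column on the same edge of the
    wrapped strand. *)
Definition base (i : nat) : nat := index i cols.

Definition first (k : nat) : bool := base (col k) == k.

(** The rectangle of radius [r] has its left side on [x = r]; closing arc [j]
    lies on the rectangle of radius [j], and the rectangle of radius
    [i + 1/2] separates it from arc [i + 1]. *)
Definition radius (i : nat) : R := i%:R + 2^-1.

Definition right (r : R) : R := n%:R * 2 + 1 - r.

Definition top (r : R) : R := c%:R + (n%:R + 1 - r).

Definition bot (r : R) : R := - (n%:R + 1 - r).

Definition on_rectangle (r x y : R) : Prop :=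
  ((x = r \/ x = right r) /\ bot r <= y <= top r) \/
  ((y = bot r \/ y = top r) /\ r <= x <= right r).

(** The vertices of the strand with the raised vertex: from [start] over [peak]
    to [finish] in the closed braid, over [bend] once it is bent.  A wrapped
    strand leaves its slab at [exit], on the near side of the other strand, and
    comes back at [entry], on its far side. *)
Definition start k : 'rV[R]_3 := pt (col k)%:R k%:R 0.

Definition finish k : 'rV[R]_3 := pt (col k).+1%:R k.+1%:R 0.

Definition peak k : 'rV[R]_3 := pt ((col k)%:R + 2^-1) (k%:R + 2^-1) (sg k).

Definition bend k : 'rV[R]_3 :=
  pt ((col k)%:R + 4^-1) (k%:R + 4^-1) (sg k / 2).

Definition exit k : 'rV[R]_3 :=
  pt (radius (col k)) (k%:R + 4^-1) (2 * sg k).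

Definition entry k : 'rV[R]_3 :=
  pt (radius (col k)) (k%:R + 3 / 4) (2 * sg k).

Definition bot_left k : 'rV[R]_3 :=
  let r := radius (col k) in pt r (bot r) (2 * sg k).

Definition bot_right k : 'rV[R]_3 :=
  let r := radius (col k) in pt (right r) (bot r) (2 * sg k).

Definition top_right k : 'rV[R]_3 :=
  let r := radius (col k) in pt (right r) (top r) (2 * sg k).

Definition top_left k : 'rV[R]_3 :=
  let r := radius (col k) in pt r (top r) (2 * sg k).

Definition peaked k : seq (edge R) := polyline [:: start k; peak k; finish k].

Definition bent k : seq (edge R) := polyline [:: start k; bend k; finish k].

Definition wrapped k : seq (edge R) :=
  polyline [:: start k; exit k; bot_left k; bot_right k; top_right k;
               top_left k; entry k; finish k].

Definition moved k : seq (edge R) := if first k then wrapped k else bent k.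

Definition still k : seq (edge R) :=
  (pt (col k).+1%:R k%:R 0, pt (col k)%:R k.+1%:R 0) ::
  [seq (pt j%:R k%:R 0, pt j%:R k.+1%:R 0)
     | j <- iota 0 n.+1 & (j != col k) && (j != (col k).+1)].

Definition strand (st : pred nat) k : seq (edge R) :=
  if st k then moved k else peaked k.

Definition arcs : seq (edge R) :=
  flatten [seq closing_arc R n c j | j <- iota 0 n.+1].

(** [st] selects the strands that have already been moved; the isotopy runs from
    [pred0] to [predT] and changes one value at a time. *)
Definition diagram (st : pred nat) : seq (edge R) :=
  flatten [seq strand st k ++ still k | k <- iota 0 c] ++ arcs.

Definition remainder (st : pred nat) k : seq (edge R) :=
  flatten [seq (if k' == k then [::] else strand st k') ++ still k'
             | k' <- iota 0 c] ++ arcs.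

Lemma mem_col k : (k < c)%N -> col k \in cols.
Proof. by move=> kc; rewrite mem_nth // size_map. Qed.

Lemma col_base i : i \in cols -> col (base i) = i.
Proof. exact: nth_index. Qed.

Lemma base_lt i : i \in cols -> (base i < c)%N.
Proof. by rewrite -index_mem size_map. Qed.

Lemma col_lt k : (k < c)%N -> (col k < n)%N.
Proof. by move=> /mem_col /mapP[l _ ->]; apply: ltn_ord. Qed.

Lemma base_le k : (k < c)%N -> (base (col k) <= k)%N.
Proof.
by move=> kc; rewrite leqNgt; apply/negP => /(before_find 0%N) /=; rewrite /col eqxx.
Qed.

Lemma closed_braid_diagram : closed_braid R w = diagram pred0.
Proof.
rewrite /closed_braid /diagram; congr (_ ++ _); congr flatten.
apply: (@eq_from_nth _ [::]) => [|k].
  by rewrite !size_map size_zip size_iota minnn.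
rewrite size_map size_zip size_iota minnn => kc.
have [l0 _] : exists l0 : 'I_n * bool, True.
  by move: kc; case: (w) => [//|l0 ? _]; exists l0.
rewrite (nth_map (0%N, l0)) ?size_zip ?size_iota ?minnn //.
rewrite (nth_map 0%N) ?size_iota // nth_zip ?size_iota //= nth_iota // add0n.
rewrite /strand /braid_slab /= /still /peaked /polyline /=.
have colE : col k = (nth l0 w k).1 by rewrite /col (nth_map l0).
have sgE : sg k = (if (nth l0 w k).2 then 1 else -1) by rewrite /sg (nth_map l0).
by rewrite /start /peak /finish colE sgE.
Qed.

Lemma mem_split_strand st k : (k < c)%N ->
  diagram st =i strand st k ++ remainder st k.
Proof.
move=> kc e; rewrite /diagram /remainder; move: (arcs) => a; rewrite !mem_cat.
case: (e \in a); first by rewrite !orbT.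
rewrite !orbF; apply/idP/idP.
  case/flatten_mapP => k' k'c; rewrite mem_cat => eK.
  have [E|nE] := eqVneq k' k.
    case/orP: eK => eK; first by rewrite -E eK.
    by apply/orP; right; apply/flatten_mapP; exists k'; rewrite // mem_cat eK orbT.
  by apply/orP; right; apply/flatten_mapP; exists k'; rewrite // (negPf nE) mem_cat.
case/orP => [eK|].
  by apply/flatten_mapP; exists k; rewrite ?mem_iota // mem_cat eK.
case/flatten_mapP => k' k'c eK; apply/flatten_mapP; exists k' => //.
by move: eK; case: eqP => // _ /= eK; rewrite mem_cat eK orbT.
Qed.

Lemma body_split_strand st k : (k < c)%N ->
  body (diagram st) = body (remainder st k) `|` body (strand st k).
Proof.
by move=> kc; rewrite (body_eq_mem (mem_split_strand st kc)) body_cat setUC.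
Qed.

Lemma closing_arcE j : (j <= n)%N -> closing_arc R n c j =
  polyline [:: pt j%:R c%:R 0; pt j%:R (top j%:R) 0;
               pt (right j%:R) (top j%:R) 0; pt (right j%:R) (bot j%:R) 0;
               pt j%:R (bot j%:R) 0; pt j%:R 0 0].
Proof.
move=> jn; have dE : (n.+1 - j)%:R = n%:R + 1 - j%:R :> R.
  by rewrite natrB ?leqW // -natr1.
have xE : (n.*2.+1 - j)%:R = right j%:R.
  rewrite natrB; last by lia.
  by rewrite -natr1 -muln2 natrM.
by rewrite /closing_arc dE xE.
Qed.

(** * The isotopy *)

Lemma sgP k : sg k = 1 \/ sg k = -1.
Proof. by rewrite /sg; case: ifP; [left | right]. Qed.

Lemma ltn_real (i j : nat) : (i < j)%N -> i%:R + 1 <= j%:R :> R.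
Proof. by move=> ij; rewrite natr1 ler_nat. Qed.

Lemma slab_bounds k : (k < c)%N ->
  [/\ 0 <= (col k)%:R :> R, (col k)%:R + 1 <= n%:R :> R, 0 <= k%:R :> R &
      k%:R + 1 <= c%:R :> R].
Proof. by move=> kc; split; rewrite ?ler0n ?ltn_real // col_lt. Qed.

Lemma between (t a b : R) : 0 <= t -> t <= 1 -> a <= b -> a <= a + t * (b - a) <= b.
Proof. by move=> *; nra. Qed.

Lemma between_down (t a b : R) :
  0 <= t -> t <= 1 -> b <= a -> b <= a + t * (b - a) <= a.
Proof. by move=> *; nra. Qed.

(** A coarse bound for the rest of the diagram, seen from slab [k], that is
    enough to keep the moves of its strand clear: outside the projection plane,
    the other slabs only matter strictly between the two levels at which strands
    are wrapped, and the wrapped strands only at these levels. *)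
Definition obstacle (st : pred nat) k (x y z : R) : Prop :=
  [\/ z = 0,
      exists k', [/\ (k' < c)%N, k' != k, k'%:R <= y <= k'%:R + 1 & -2 < z < 2]
    | exists k', [/\ (k' < c)%N, k' != k, st k' && first k', z = 2 \/ z = -2 &
                     on_rectangle (radius (col k')) x y]].

(** A wrapped strand climbs from [start] to [exit] inside its own slab and
    reaches the level of the rectangles only at [exit]; likewise at [entry]. *)
Lemma remainder_obstacle st k x y z :
  body (remainder st k) (pt x y z) -> obstacle st k x y z.
Proof.
case=> e; rewrite /remainder mem_cat => /orP[/flatten_mapP[k']|]; last first.
  case/flatten_mapP => j; rewrite mem_iota add0n ltnS => /andP[_ jn].
  rewrite (closing_arcE jn) !inE => eK pe; constructor 1; move: eK pe.
  by do ?case/orP; move=> /eqP-> /seg_pt[t [? ? _ _ ->]]; rewrite subrr mulr0 addr0.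
rewrite mem_iota add0n => /andP[_ k'c]; rewrite mem_cat => /orP[|]; last first.
  move=> eK pe; constructor 1; move: eK pe; rewrite inE.
  case/orP=> [/eqP->|/mapP[j _ ->]] /seg_pt[t [? ? _ _ ->]];
  by rewrite subrr mulr0 addr0.
case: ifP => // /negbT nk; rewrite /strand.
have [i0 iN k0 kC] := slab_bounds k'c; have s1 := sgP k'.
have near_slab : k'%:R <= y <= k'%:R + 1 -> -2 < z < 2 -> obstacle st k x y z.
  by move=> ? ?; constructor 2; exists k'.
have peaked_case : e \in peaked k' -> seg e.1 e.2 (pt x y z) -> obstacle st k x y z.
  rewrite !inE => /orP[]/eqP-> /seg_pt[t [? ? _ yE zE]];
  by apply: near_slab; move: s1 => [] sE; rewrite sE in zE; lra.
case: ifP => [stk|//]; rewrite /moved; case: ifP => [fk|_]; last first.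
  rewrite !inE => /orP[]/eqP-> /seg_pt[t [? ? _ yE zE]];
  by apply: near_slab; move: s1 => [] sE; rewrite sE in zE; lra.
have wrap : z = 2 * sg k' -> on_rectangle (radius (col k')) x y ->
    obstacle st k x y z.
  move=> zE ?; constructor 3; exists k'; split=> //; first by rewrite stk fk.
  by move: s1 zE => [] -> ->; [left | right]; lra.
rewrite !inE; do ?case/orP; move=> /eqP-> /seg_pt[t [t0 t1 xE yE zE]];
  rewrite /on_rectangle /top /bot /right /radius in wrap xE yE.
- have [t_1|t_1] := eqVneq t 1.
    by apply: wrap; rewrite ?zE ?xE ?yE ?t_1; [lra | left; split; [left|]; lra].
  have : t < 1 by rewrite lt_neqAle t_1.
  by move=> ?; apply: near_slab; move: s1 => [] sE; rewrite sE in zE; lra.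
- apply: wrap; first by lra.
  have := between_down t0 t1 (_ : - (n%:R + 1 - ((col k')%:R + 2^-1)) <= k'%:R + 4^-1).
  rewrite -yE => yb; left; split; [left|]; lra.
- apply: wrap; first by lra.
  have := between t0 t1 (_ : (col k')%:R + 2^-1 <= n%:R * 2 + 1 - ((col k')%:R + 2^-1)).
  rewrite -xE => xb; right; split; [left|]; lra.
- apply: wrap; first by lra.
  have := between t0 t1 (_ : - (n%:R + 1 - ((col k')%:R + 2^-1)) <=
                            c%:R + (n%:R + 1 - ((col k')%:R + 2^-1))).
  rewrite -yE => yb; left; split; [right|]; lra.
- apply: wrap; first by lra.
  have := between_down t0 t1
    (_ : (col k')%:R + 2^-1 <= n%:R * 2 + 1 - ((col k')%:R + 2^-1)).
  rewrite -xE => xb; right; split; [right|]; lra.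
- apply: wrap; first by lra.
  have := between_down t0 t1
    (_ : k'%:R + 3 / 4 <= c%:R + (n%:R + 1 - ((col k')%:R + 2^-1))).
  rewrite -yE => yb; left; split; [left|]; lra.
- have [t_0|t_0] := eqVneq t 0.
    by apply: wrap; rewrite ?zE ?xE ?yE ?t_0; [lra | left; split; [left|]; lra].
  have : 0 < t by rewrite lt_neqAle eq_sym t_0.
  by move=> ?; apply: near_slab; move: s1 => [] sE; rewrite sE in zE; lra.
Qed.

(** Different slabs share at most one of the planes [y = k], [y = k + 1]. *)
Lemma low_obstacle st k x y z : obstacle st k x y z ->
  k%:R <= y <= k%:R + 1 -> -2 < z < 2 -> [\/ z = 0, y = k%:R | y = k%:R + 1].
Proof.
case=> [->|[k' [_ nk yk' _]]|[k' [_ _ _ zE _]]] yk zlt; first by constructor 1.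
  move: nk; rewrite neq_ltn => /orP[] /ltn_real lt_k.
    by constructor 2; lra.
  by constructor 3; lra.
by exfalso; case: zE => zE; lra.
Qed.

Definition outermost (st : pred nat) k : Prop :=
  forall k', (k' < c)%N -> k' != k -> st k' -> first k' -> (col k' < col k)%N.

(** The disk bounded by the rectangle of column [col k] contains no strand
    wrapped along a wider rectangle; this is why columns are treated from the
    outside to the inside. *)
Lemma high_obstacle st k x y z : (k < c)%N -> outermost st k ->
  (col k)%:R <= x <= right (radius (col k)) ->
  bot (radius (col k)) <= y <= top (radius (col k)) ->
  z = 2 \/ z = -2 -> ~ obstacle st k x y z.
Proof.
move=> kc out xb yb zE; case=> [z0|[k' [_ _ _ zlt]]|].
- by case: zE; lra.
- by case: zE; lra.
case=> k' [k'c nk /andP[stk' fk'] _].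
have := ltn_real (out k' k'c nk stk' fk').
rewrite /on_rectangle /right /bot /top /radius in xb yb * => lt_col.
by case=> -[[] E yb']; lra.
Qed.

(** Swinging the raised vertex back along its own segment moves it off the
    crossing point of the projection. *)
Lemma bend_peaked (S : set 'rV[R]_3) st k :
  (forall x y z, S (pt x y z) -> obstacle st k x y z) ->
  link_equiv (S `|` body (peaked k)) (S `|` body (bent k)).
Proof.
move=> obs; rewrite /peaked /bent /polyline /= !body_cons body_nil !setU0.
have s1 := sgP k.
have -> : seg (start k) (peak k) = seg (start k) (bend k) `|` seg (bend k) (peak k).
  by apply: seg_split; apply/seg_pt; exists 2^-1; split; lra.
apply: link_equiv_sym.
have := @detour R (S `|` seg (start k) (bend k)) (bend k) (finish k) (peak k).
rewrite -!setUA; apply.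
  rewrite !ptB; apply: independent_pt => s t.
  by case: s1 => -> *; split; lra.
move=> v; have [x [y [z ->]]] := pt_surj v.
case=> [/obs/low_obstacle vS|/seg_pt[r [r0 r1 xr yr zr]]]
  /triangle_pt[s [t [s0 t0 st1 [xE yE zE]]]].
  have [z0|yk|yk] : [\/ z = 0, y = k%:R | y = k%:R + 1].
    by apply: vS; [|move: s1 => [] sE; rewrite sE in zE]; lra.
  - by right; congr pt; move: s1 => [] sE; rewrite sE in zE; lra.
  - by exfalso; lra.
  - by right; congr pt; move: s1 => [] sE; rewrite sE in zE; lra.
by left; congr pt; move: s1 => [] sE; rewrite sE in zE zr *; lra.
Qed.

Lemma level k z : z = 2 * sg k -> z = 2 \/ z = -2.
Proof. by case: (sgP k) => -> ->; [left | right]; lra. Qed.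

Lemma eq0_gap (t a b : R) : a < b \/ b < a -> t * (b - a) = 0 -> t = 0.
Proof.
by move=> ab /eqP; rewrite mulf_eq0 => /orP[]/eqP //; case: ab; lra.
Qed.

(** The raised vertex is pulled up (or down) to the level of the wrapped
    strands, and its two sides are pushed apart to [exit] and [entry]. *)
Lemma lift_start (S : set 'rV[R]_3) st k : (k < c)%N -> outermost st k ->
  (forall x y z, S (pt x y z) -> obstacle st k x y z) ->
  link_equiv (S `|` (seg (start k) (peak k) `|` seg (peak k) (finish k)))
    (S `|` (seg (start k) (exit k) `|` (seg (exit k) (peak k) `|`
       seg (peak k) (finish k)))).
Proof.
move=> kc out obs.
have := @detour R (S `|` seg (peak k) (finish k)) (start k) (peak k) (exit k).
set A := (X in _ -> _ -> link_equiv X _); set B := (X in _ -> _ -> link_equiv _ X).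
have -> : A = S `|` (seg (start k) (peak k) `|` seg (peak k) (finish k)).
  by apply/predeqP => v; rewrite /A /setU /mkset; tauto.
have -> : B = S `|` (seg (start k) (exit k) `|`
    (seg (exit k) (peak k) `|` seg (peak k) (finish k))).
  by apply/predeqP => v; rewrite /B /setU /mkset; tauto.
have s1 := sgP k; apply.
  rewrite !ptB; apply: independent_pt => s t; rewrite /radius.
  by case: s1 => -> *; split; lra.
move=> v vS vt; move: vS vt; have [x [y [z ->]]] := pt_surj v.
case=> [/obs vS|/seg_pt[r [r0 r1 xr yr zr]]]
  /triangle_pt[s [t [s0 t0 st1 [xE yE zE]]]]; rewrite /radius in xE; last first.
  by right; congr pt; clear -s0 t0 st1 xE yE zE r0 r1 xr yr zr s1;
    move: s1 => [] sE; rewrite sE in zE zr *; lra.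
left; have [t_1|t_1] := eqVneq t 1.
  have [i0 iN k0 kC] := slab_bounds kc.
  have s_0 : s = 0 by lra.
  rewrite t_1 s_0 in xE yE zE; case: (high_obstacle kc out _ _ _ vS);
    rewrite /right /bot /top /radius; [lra | lra | apply: (@level k); lra].
have {}t_1 : t < 1 by rewrite lt_neqAle t_1; lra.
have [z0|yk|yk] : [\/ z = 0, y = k%:R | y = k%:R + 1].
  by apply: (low_obstacle vS); [|move: s1 => [] sE; rewrite sE in zE]; lra.
- by congr pt; move: s1 => [] sE; rewrite sE in zE; lra.
- by congr pt; move: s1 => [] sE; rewrite sE in zE; lra.
- by exfalso; lra.
Qed.

Lemma lift_finish (S : set 'rV[R]_3) st k : (k < c)%N -> outermost st k ->
  (forall x y z, S (pt x y z) -> obstacle st k x y z) ->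
  link_equiv
    (S `|` (seg (start k) (exit k) `|` (seg (exit k) (peak k) `|`
       seg (peak k) (finish k))))
    (S `|` (seg (start k) (exit k) `|` (seg (exit k) (peak k) `|`
       (seg (peak k) (entry k) `|` seg (entry k) (finish k))))).
Proof.
move=> kc out obs.
have := @detour R (S `|` (seg (start k) (exit k) `|` seg (exit k) (peak k)))
  (peak k) (finish k) (entry k).
have s1 := sgP k; rewrite -!setUA; apply.
  rewrite !ptB; apply: independent_pt => s t; rewrite /radius.
  by case: s1 => -> *; split; lra.
move=> v vS vt; move: vS vt; have [x [y [z ->]]] := pt_surj v.
case=> [/obs vS|vS] /triangle_pt[s [t [s0 t0 st1 [xE yE zE]]]];
  rewrite /radius in xE; last first.
  left; case: vS => /seg_pt[r [r0 r1 xr yr zr]]; rewrite /radius in xr;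
    by congr pt; clear -s0 t0 st1 xE yE zE r0 r1 xr yr zr s1;
      move: s1 => [] sE; rewrite sE in zE zr *; lra.
right; have [t_1|t_1] := eqVneq t 1.
  have [i0 iN k0 kC] := slab_bounds kc.
  have s_0 : s = 0 by lra.
  rewrite t_1 s_0 in xE yE zE; case: (high_obstacle kc out _ _ _ vS);
    rewrite /right /bot /top /radius; [lra | lra | apply: (@level k); lra].
have {}t_1 : t < 1 by rewrite lt_neqAle t_1; lra.
have [z0|yk|yk] : [\/ z = 0, y = k%:R | y = k%:R + 1].
  by apply: (low_obstacle vS); [|move: s1 => [] sE; rewrite sE in zE]; lra.
- by congr pt; move: s1 => [] sE; rewrite sE in zE; lra.
- by exfalso; lra.
- by congr pt; move: s1 => [] sE; rewrite sE in zE; lra.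
Qed.

Lemma drop_peak (S : set 'rV[R]_3) st k : (k < c)%N -> outermost st k ->
  (forall x y z, S (pt x y z) -> obstacle st k x y z) ->
  link_equiv
    (S `|` (seg (start k) (exit k) `|` (seg (exit k) (peak k) `|`
       (seg (peak k) (entry k) `|` seg (entry k) (finish k)))))
    (S `|` (seg (start k) (exit k) `|` (seg (exit k) (entry k) `|`
       seg (entry k) (finish k)))).
Proof.
move=> kc out obs; apply: link_equiv_sym.
have := @detour R (S `|` (seg (start k) (exit k) `|` seg (entry k) (finish k)))
  (exit k) (entry k) (peak k).
set A := (X in _ -> _ -> link_equiv X _); set B := (X in _ -> _ -> link_equiv _ X).
have -> : A = S `|` (seg (start k) (exit k) `|`
    (seg (exit k) (entry k) `|` seg (entry k) (finish k))).
  by apply/predeqP => v; rewrite /A /setU /mkset; tauto.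
have -> : B = S `|` (seg (start k) (exit k) `|` (seg (exit k) (peak k) `|`
    (seg (peak k) (entry k) `|` seg (entry k) (finish k)))).
  by apply/predeqP => v; rewrite /B /setU /mkset; tauto.
have s1 := sgP k; apply.
  rewrite !ptB; apply: independent_pt => s t; rewrite /radius.
  by case: s1 => -> *; split; lra.
move=> v vS vt; move: vS vt; have [x [y [z ->]]] := pt_surj v.
case=> [/obs vS|vS] /triangle_pt[s [t [s0 t0 st1 [xE yE zE]]]];
  rewrite /radius in xE; last first.
  case: vS => /seg_pt[r [r0 r1 xr yr zr]]; [left | right];
    by congr pt; rewrite ?/radius in xr *; clear -s0 t0 st1 xE yE zE r0 r1 xr yr zr s1;
      move: s1 => [] sE; rewrite sE in zE zr *; lra.
exfalso; have [t_0|t_0] := eqVneq t 0.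
  have [i0 iN k0 kC] := slab_bounds kc.
  rewrite t_0 in xE yE zE; case: (high_obstacle kc out _ _ _ vS);
    rewrite /right /bot /top /radius; [lra | lra | apply: (@level k); lra].
have {}t_0 : 0 < t by rewrite lt_neqAle eq_sym t_0; lra.
have [z0|yk|yk] : [\/ z = 0, y = k%:R | y = k%:R + 1].
  by apply: (low_obstacle vS); [|move: s1 => [] sE; rewrite sE in zE]; lra.
- by move: s1 => [] sE; rewrite sE in zE; lra.
- by lra.
- by lra.
Qed.

(** Once it runs from [exit] to [entry], the strand is pushed at constant
    height across the disk bounded by the rectangle of its column: to the
    right, and from there down and up. *)
Lemma sweep_disk (S : set 'rV[R]_3) st k : (k < c)%N -> outermost st k ->
  (forall x y z, S (pt x y z) -> obstacle st k x y z) ->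
  link_equiv
    (S `|` (seg (start k) (exit k) `|` (seg (exit k) (entry k) `|`
       seg (entry k) (finish k))))
    (S `|` (seg (start k) (exit k) `|` (seg (exit k) (bot_left k) `|`
      (seg (bot_left k) (bot_right k) `|` (seg (bot_right k) (top_right k) `|`
      (seg (top_right k) (top_left k) `|` (seg (top_left k) (entry k) `|`
       seg (entry k) (finish k)))))))).
Proof.
move=> kc out obs; have s1 := sgP k; have [i0 iN k0 kC] := slab_bounds kc.
set r := radius (col k).
have rl : (col k)%:R <= r by rewrite /r /radius; lra.
have rr : r < right r by rewrite /right /r /radius; lra.
have bk : bot r < k%:R + 4^-1 by rewrite /bot /r /radius; lra.
have kt : k%:R + 3 / 4 < top r by rewrite /top /r /radius; lra.
have clear_disk x y z : r <= x <= right r -> bot r <= y <= top r ->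
    z = 2 * sg k -> ~ S (pt x y z).
  by move=> xb yb /level zE /obs; apply: high_obstacle => //; rewrite -/r; lra.
(* The points of the right side level with [exit] and [entry], where the three
   pushes meet. *)
pose e' : 'rV[R]_3 := pt (right r) (k%:R + 4^-1) (2 * sg k).
pose n' : 'rV[R]_3 := pt (right r) (k%:R + 3 / 4) (2 * sg k).
have -> : seg (bot_right k) (top_right k) =
    seg (bot_right k) e' `|` (seg e' n' `|` seg n' (top_right k)).
  have /seg_split -> : seg (bot_right k) (top_right k) e'.
    apply/seg_pt; rewrite -/r; exists ((k%:R + 4^-1 - bot r) / (top r - bot r)).
    split; [by rewrite divr_ge0 //; lra|by rewrite ler_pdivrMr; lra|ring| |ring].
    by field; lra.
  congr (_ `|` _); apply: seg_split; apply/seg_pt; rewrite -/r.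
  exists (2^-1 / (top r - (k%:R + 4^-1))).
  split; [by rewrite divr_ge0 //; lra|by rewrite ler_pdivrMr; lra|ring| |ring].
  by field; lra.
(* The edges joining the slab to [exit] and [entry] reach the level of the disk
   only at these points. *)
have at_level t z : 0 <= t -> t <= 1 -> z = 2 * sg k -> z = 0 + t * (2 * sg k - 0) ->
    t = 1.
  by clear -s1; case: s1 => ->; lra.
have at_level' t z : 0 <= t -> t <= 1 -> z = 2 * sg k ->
    z = 2 * sg k + t * (0 - 2 * sg k) -> t = 0.
  by clear -s1; case: s1 => ->; lra.
apply: (link_equiv_trans (B := S `|` (seg (start k) (exit k) `|`
  ((seg (exit k) e' `|` seg e' n' `|` seg n' (entry k)) `|` seg (entry k) (finish k))))).
  have := @parallelogram_detour R
    (S `|` (seg (start k) (exit k) `|` seg (entry k) (finish k))) (exit k) (entry k) e' n'.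
  set A := (X in _ -> _ -> _ -> link_equiv X _).
  set B := (X in _ -> _ -> _ -> link_equiv _ X).
  have -> : A = S `|` (seg (start k) (exit k) `|`
      (seg (exit k) (entry k) `|` seg (entry k) (finish k))).
    by apply/predeqP => v; rewrite /A /setU /mkset; tauto.
  have -> : B = S `|` (seg (start k) (exit k) `|`
    ((seg (exit k) e' `|` seg e' n' `|` seg n' (entry k)) `|` seg (entry k) (finish k))).
    by apply/predeqP => v; rewrite /B /setU /mkset; tauto.
  clear A B; apply.
  - by rewrite !ptB; congr pt; lra.
  - rewrite !ptB -/r; apply: independent_pt => s t xst yst _.
    have s_0 : s = 0 by lra.
    by split=> //; apply: (eq0_gap (or_introl rr)); lra.
  move=> v s t /andP[s0 s_1] /andP[t0 t_1]; have [x [y [z ->]]] := pt_surj v.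
  rewrite !ptB !ptZ !ptD -/r => /pt_inj[xE yE zE].
  have xb := between t0 t_1 (ltW rr).
  have {}zE : z = 2 * sg k by lra.
  case=> [|[]/seg_pt[u [u0 u1 xu yu zu]]].
  + by move=> vS; exfalso; apply: clear_disk vS; lra.
  + rewrite -?/r in xu yu; have u_1 := at_level _ _ u0 u1 zE zu; rewrite u_1 in xu yu.
    by left; congr pt; rewrite -/r; clear clear_disk at_level at_level'; lra.
  + rewrite -?/r in xu yu; have u_0 := at_level' _ _ u0 u1 zE zu; rewrite u_0 in xu yu.
    by right; congr pt; rewrite -/r; clear clear_disk at_level at_level'; lra.
apply: (link_equiv_trans (B := S `|` (seg (start k) (exit k) `|`
  ((seg (exit k) (bot_left k) `|` seg (bot_left k) (bot_right k) `|`
    seg (bot_right k) e') `|` (seg e' n' `|` (seg n' (entry k) `|`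
    seg (entry k) (finish k))))))).
  have := @parallelogram_detour R (S `|` (seg (start k) (exit k) `|`
    (seg e' n' `|` (seg n' (entry k) `|` seg (entry k) (finish k)))))
    (exit k) e' (bot_left k) (bot_right k).
  set A := (X in _ -> _ -> _ -> link_equiv X _).
  set B := (X in _ -> _ -> _ -> link_equiv _ X).
  have -> : A = S `|` (seg (start k) (exit k) `|`
      ((seg (exit k) e' `|` seg e' n' `|` seg n' (entry k)) `|` seg (entry k) (finish k))).
    by apply/predeqP => v; rewrite /A /setU /mkset; tauto.
  have -> : B = S `|` (seg (start k) (exit k) `|`
      ((seg (exit k) (bot_left k) `|` seg (bot_left k) (bot_right k) `|`
    seg (bot_right k) e') `|` (seg e' n' `|` (seg n' (entry k) `|`
    seg (entry k) (finish k))))).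
    by apply/predeqP => v; rewrite /B /setU /mkset; tauto.
  clear A B; apply.
  - by rewrite !ptB; congr pt; lra.
  - rewrite !ptB -/r; apply: independent_pt => s t xst yst _.
    by split; [apply: (eq0_gap (or_introl rr)) | apply: (eq0_gap (or_intror bk))]; lra.
  move=> v s t /andP[s0 s_1] /andP[t0 t_1]; have [x [y [z ->]]] := pt_surj v.
  rewrite !ptB !ptZ !ptD -/r => /pt_inj[xE yE zE].
  have xb := between s0 s_1 (ltW rr).
  have yb := between_down t0 t_1 (ltW bk).
  have {}zE : z = 2 * sg k by lra.
  case=> [|[/seg_pt[u [u0 u1 xu yu zu]]|[/seg_pt[u [u0 u1 xu yu zu]]|
           []/seg_pt[u [u0 u1 xu yu zu]]]]].
  + by move=> vS; exfalso; apply: clear_disk vS; lra.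
  + rewrite -?/r in xu yu; have u_1 := at_level _ _ u0 u1 zE zu; rewrite u_1 in xu yu.
    by left; congr pt; rewrite -/r; clear clear_disk at_level at_level'; lra.
  + rewrite -?/r in xu yu; clear clear_disk at_level at_level'.
    by right; congr pt; rewrite -/r; lra.
  + rewrite -?/r in xu yu; clear clear_disk at_level at_level'.
    by exfalso; lra.
  + rewrite -?/r in xu yu; have u_0 := at_level' _ _ u0 u1 zE zu; rewrite u_0 in xu yu.
    by clear clear_disk at_level at_level'; exfalso; lra.
have := @parallelogram_detour R (S `|` (seg (start k) (exit k) `|`
    (seg (exit k) (bot_left k) `|` (seg (bot_left k) (bot_right k) `|`
    (seg (bot_right k) e' `|` (seg e' n' `|` seg (entry k) (finish k)))))))
    n' (entry k) (top_right k) (top_left k).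
set A := (X in _ -> _ -> _ -> link_equiv X _).
set B := (X in _ -> _ -> _ -> link_equiv _ X).
set A' := (X in _ -> link_equiv X _).
set B' := (X in _ -> link_equiv _ X).
have -> : A = A'.
  by apply/predeqP => v; rewrite /A /A' /setU /mkset; tauto.
have -> : B = B'.
  by apply/predeqP => v; rewrite /B /B' /setU /mkset; tauto.
apply; clear A B A' B'.
- by rewrite !ptB; congr pt; lra.
- rewrite !ptB -/r; apply: independent_pt => s t xst yst _.
  by split; [apply: (eq0_gap (or_intror rr)) | apply: (eq0_gap (or_introl kt))]; lra.
move=> v s t /andP[s0 s_1] /andP[t0 t_1]; have [x [y [z ->]]] := pt_surj v.
rewrite !ptB !ptZ !ptD -/r => /pt_inj[xE yE zE].
have xb := between_down s0 s_1 (ltW rr).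
have yb := between t0 t_1 (ltW kt).
have {}zE : z = 2 * sg k by lra.
case=> [|[/seg_pt[u [u0 u1 xu yu zu]]|[/seg_pt[u [u0 u1 xu yu zu]]|
         [/seg_pt[u [u0 u1 xu yu zu]]|[/seg_pt[u [u0 u1 xu yu zu]]|
         []/seg_pt[u [u0 u1 xu yu zu]]]]]]].
+ by move=> vS; exfalso; apply: clear_disk vS; lra.
+ rewrite -?/r in xu yu; clear clear_disk at_level at_level'.
  by exfalso; lra.
+ rewrite -?/r in xu yu; have ub := between_down u0 u1 (ltW bk).
  by exfalso; clear clear_disk at_level at_level'; lra.
+ rewrite -?/r in xu yu; clear clear_disk at_level at_level'.
  by exfalso; lra.
+ rewrite -?/r in xu yu; have ub := between u0 u1 (ltW bk).
  by exfalso; clear clear_disk at_level at_level'; lra.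
+ rewrite -?/r in xu yu; clear clear_disk at_level at_level'.
  by left; congr pt; rewrite -/r; lra.
+ rewrite -?/r in xu yu; have u_0 := at_level' _ _ u0 u1 zE zu; rewrite u_0 in xu yu.
  by right; congr pt; rewrite -/r; clear clear_disk at_level at_level'; lra.
Qed.

Lemma wrap_peaked (S : set 'rV[R]_3) st k : (k < c)%N -> outermost st k ->
  (forall x y z, S (pt x y z) -> obstacle st k x y z) ->
  link_equiv (S `|` body (peaked k)) (S `|` body (wrapped k)).
Proof.
move=> kc out obs; rewrite /peaked /wrapped /polyline /= !body_cons body_nil !setU0.
apply: link_equiv_trans (lift_start kc out obs) _.
apply: link_equiv_trans (lift_finish kc out obs) _.
apply: link_equiv_trans (drop_peak kc out obs) _.
exact: sweep_disk out obs.
Qed.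

Lemma eq_remainder st st' k : (forall k', k' != k -> st k' = st' k') ->
  remainder st k = remainder st' k.
Proof.
move=> eq_st; rewrite /remainder; congr (_ ++ _); congr flatten.
by apply: eq_map => k'; rewrite /strand; case: eqP => // /eqP /eq_st ->.
Qed.

Lemma eq_diagram st st' : (forall k, (k < c)%N -> st k = st' k) ->
  diagram st = diagram st'.
Proof.
move=> eq_st; rewrite /diagram; congr (_ ++ _); congr flatten.
apply/eq_in_map => k; rewrite mem_iota => /andP[_ kc].
by rewrite /strand eq_st.
Qed.

(** Columns are treated one after the other, outermost first, and each column
    slab by slab. *)
Definition stage i m : pred nat := fun k => (col k < i)%N || (col k == i) && (k < m)%N.

(** Among the strands moved before slab [m], those of the same column are bent
    and those that are wrapped belong to wider circles. *)
Lemma stage_step i m : (m < c)%N ->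
  link_equiv (body (diagram (stage i m))) (body (diagram (stage i m.+1))).
Proof.
move=> mc; have off k : k != m -> stage i m k = stage i m.+1 k.
  by move=> nk; rewrite /stage ltnS [(k <= m)%N]leq_eqVlt (negPf nk).
have [colm|colm] := eqVneq (col m) i; last first.
  rewrite (@eq_diagram (stage i m) (stage i m.+1)); first exact: rst_refl.
  move=> k kc; have [->|/off //] := eqVneq k m.
  by rewrite /stage (negPf colm).
rewrite !(body_split_strand _ mc) (eq_remainder off).
have -> : strand (stage i m) m = peaked m.
  by rewrite /strand /stage colm ltnn ltnn andbF.
have -> : strand (stage i m.+1) m = moved m.
  by rewrite /strand /stage colm eqxx ltnSn orbT.
have obs x y z : body (remainder (stage i m.+1) m) (pt x y z) ->
    obstacle (stage i m.+1) m x y z by exact: remainder_obstacle.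
rewrite /moved; case: ifP => fm; last exact: bend_peaked obs.
apply: (wrap_peaked mc _ obs) => k kc nk stk fk.
move: stk; rewrite -off // /stage -colm => /orP[//|/andP[/eqP colk _]].
by case/eqP: nk; rewrite -(eqP fk) -(eqP fm) colk.
Qed.

Lemma stage_column i :
  link_equiv (body (diagram (stage i 0))) (body (diagram (stage i c))).
Proof.
suff: forall m, (m <= c)%N ->
    link_equiv (body (diagram (stage i 0))) (body (diagram (stage i m))).
  by apply.
elim=> [_|m IHm mc]; first exact: rst_refl.
exact: link_equiv_trans (IHm (ltnW mc)) (stage_step i mc).
Qed.

Lemma closed_braid_moved :
  link_equiv (body (closed_braid R w)) (body (diagram predT)).
Proof.
rewrite closed_braid_diagram.
have -> : diagram pred0 = diagram (stage 0 0).
  by apply: eq_diagram => k _; rewrite /stage !ltn0 andbF.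
have -> : diagram predT = diagram (stage n 0).
  by apply: eq_diagram => k kc; rewrite /stage col_lt.
suff: forall i, link_equiv (body (diagram (stage 0 0))) (body (diagram (stage i 0))).
  by apply.
elim=> [|i IHi]; first exact: rst_refl.
apply: link_equiv_trans IHi _; apply: link_equiv_trans (stage_column i) _.
rewrite (@eq_diagram (stage i c) (stage i.+1 0)); first exact: rst_refl.
by move=> k kc; rewrite /stage kc andbT andbF orbF ltnS [(col k <= i)%N]leq_eqVlt orbC.
Qed.

(** * The projection of the wrapped diagram *)

(** Edges are compared through their names, as coordinates do not show which
    piece of the diagram they belong to.  [Vert k j] and [Back k] are
    the edges in the plane of slab [k], [Bent1 k] and [Bent2 k] the two edges of
    a bent strand, [Wrap0 k], ..., [Wrap6 k] the edges of a wrapped strand in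
    order, and [Arc0 j], ..., [Arc4 j] those of a closing arc. *)
Inductive name : Type :=
| Vert of nat & nat | Back of nat | Bent1 of nat | Bent2 of nat
| Wrap0 of nat | Wrap1 of nat | Wrap2 of nat | Wrap3 of nat | Wrap4 of nat
| Wrap5 of nat | Wrap6 of nat
| Arc0 of nat | Arc1 of nat | Arc2 of nat | Arc3 of nat | Arc4 of nat.

Definition valid (d : name) : bool :=
  match d with
  | Vert k j => [&& (k < c)%N, (j <= n)%N, j != col k & j != (col k).+1]
  | Back k => (k < c)%N
  | Bent1 k | Bent2 k => (k < c)%N && ~~ first k
  | Wrap0 k | Wrap1 k | Wrap2 k | Wrap3 k | Wrap4 k | Wrap5 k | Wrap6 k =>
      (k < c)%N && first k
  | Arc0 j | Arc1 j | Arc2 j | Arc3 j | Arc4 j => (j <= n)%N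
  end.

Definition named_edge (d : name) : edge R :=
  match d with
  | Vert k j => (pt j%:R k%:R 0, pt j%:R k.+1%:R 0)
  | Back k => (pt (col k).+1%:R k%:R 0, pt (col k)%:R k.+1%:R 0)
  | Bent1 k => (start k, bend k)
  | Bent2 k => (bend k, finish k)
  | Wrap0 k => (start k, exit k)
  | Wrap1 k => (exit k, bot_left k)
  | Wrap2 k => (bot_left k, bot_right k)
  | Wrap3 k => (bot_right k, top_right k)
  | Wrap4 k => (top_right k, top_left k)
  | Wrap5 k => (top_left k, entry k)
  | Wrap6 k => (entry k, finish k)
  | Arc0 j => (pt j%:R c%:R 0, pt j%:R (top j%:R) 0)
  | Arc1 j => (pt j%:R (top j%:R) 0, pt (right j%:R) (top j%:R) 0)
  | Arc2 j => (pt (right j%:R) (top j%:R) 0, pt (right j%:R) (bot j%:R) 0)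
  | Arc3 j => (pt (right j%:R) (bot j%:R) 0, pt j%:R (bot j%:R) 0)
  | Arc4 j => (pt j%:R (bot j%:R) 0, pt j%:R 0 0)
  end.

(** The projection of an edge without its second endpoint.  Cutting the diagram
    into half-open edges makes it a disjoint union away from the crossings. *)
Definition cell (d : name) (x y : R) : Prop :=
  match d with
  | Vert k j => x = j%:R /\ k%:R <= y < k%:R + 1
  | Back k => x + y = (col k)%:R + 1 + k%:R /\ k%:R <= y < k%:R + 1
  | Bent1 k => x - (col k)%:R = y - k%:R /\ k%:R <= y < k%:R + 4^-1
  | Bent2 k => x - (col k)%:R = y - k%:R /\ k%:R + 4^-1 <= y < k%:R + 1
  | Wrap0 k => x - (col k)%:R = 2 * (y - k%:R) /\ k%:R <= y < k%:R + 4^-1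
  | Wrap1 k => let r := radius (col k) in x = r /\ bot r < y <= k%:R + 4^-1
  | Wrap2 k => let r := radius (col k) in y = bot r /\ r <= x < right r
  | Wrap3 k => let r := radius (col k) in x = right r /\ bot r <= y < top r
  | Wrap4 k => let r := radius (col k) in y = top r /\ r < x <= right r
  | Wrap5 k => let r := radius (col k) in x = r /\ k%:R + 3 / 4 < y <= top r
  | Wrap6 k => x - (col k)%:R - 1 = 2 * (y - k%:R - 1) /\
               k%:R + 3 / 4 <= y < k%:R + 1
  | Arc0 j => x = j%:R /\ c%:R <= y < top j%:R
  | Arc1 j => y = top j%:R /\ j%:R <= x < right j%:R
  | Arc2 j => x = right j%:R /\ bot j%:R < y <= top j%:R
  | Arc3 j => y = bot j%:R /\ j%:R < x <= right j%:R
  | Arc4 j => x = j%:R /\ bot j%:R <= y < 0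
  end.

Lemma moved_diagramP e :
  e \in diagram predT <-> exists2 d, valid d & e = named_edge d.
Proof.
rewrite /diagram mem_cat; split=> [/orP[]/flatten_mapP|].
- case=> k; rewrite mem_iota add0n => /andP[_ kc]; rewrite mem_cat /strand /moved /=.
  case/orP; first case: ifP => fk; rewrite !inE; do ?case/orP; try move/eqP->.
  + by exists (Wrap0 k); rewrite //= kc.
  + by exists (Wrap1 k); rewrite //= kc.
  + by exists (Wrap2 k); rewrite //= kc.
  + by exists (Wrap3 k); rewrite //= kc.
  + by exists (Wrap4 k); rewrite //= kc.
  + by exists (Wrap5 k); rewrite //= kc.
  + by exists (Wrap6 k); rewrite //= kc.
  + by exists (Bent1 k); rewrite //= kc fk.
  + by exists (Bent2 k); rewrite //= kc fk.
  + by exists (Back k).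
  case/mapP=> j; rewrite mem_filter mem_iota add0n ltnS => /andP[jcol /andP[_ jn]] ->.
  by exists (Vert k j); rewrite //= kc jn.
- case=> j; rewrite mem_iota add0n ltnS => /andP[_ jn].
  rewrite (closing_arcE jn) !inE; do ?case/orP; move/eqP->.
  + by exists (Arc0 j).
  + by exists (Arc1 j).
  + by exists (Arc2 j).
  + by exists (Arc3 j).
  + by exists (Arc4 j).
have in_slab k e' : (k < c)%N -> e' \in moved k ++ still k ->
    (e' \in flatten [seq strand predT k ++ still k | k <- iota 0 c]) ||
    (e' \in arcs).
  by move=> kc e'k; apply/orP; left; apply/flatten_mapP; exists k; rewrite // mem_iota.
have in_arc j e' : (j <= n)%N -> e' \in closing_arc R n c j ->
    (e' \in flatten [seq strand predT k ++ still k | k <- iota 0 c]) ||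
    (e' \in arcs).
  move=> jn e'j; apply/orP; right; apply/flatten_mapP; exists j => //.
  by rewrite mem_iota ltnS.
case=> d + ->; case: d => [k j|k|k|k|k|k|k|k|k|k|k|j|j|j|j|j];
  rewrite [valid _]/= [named_edge _]/=.
- move=> /and4P[kc jn j1 j2]; apply: (in_slab k _ kc); rewrite mem_cat inE.
  apply/orP; right; apply/orP; right; apply/mapP; exists j => //.
  by rewrite mem_filter j1 j2 mem_iota ltnS.
- by move=> kc; apply: (in_slab k _ kc); rewrite mem_cat mem_head orbT.
- by move=> /andP[kc /negPf fk]; apply: (in_slab k _ kc); rewrite /moved fk !inE eqxx.
- by move=> /andP[kc /negPf fk]; apply: (in_slab k _ kc); rewrite /moved fk !inE eqxx ?orbT.
- by move=> /andP[kc fk]; apply: (in_slab k _ kc); rewrite /moved fk !inE eqxx ?orbT.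
- by move=> /andP[kc fk]; apply: (in_slab k _ kc); rewrite /moved fk !inE eqxx ?orbT.
- by move=> /andP[kc fk]; apply: (in_slab k _ kc); rewrite /moved fk !inE eqxx ?orbT.
- by move=> /andP[kc fk]; apply: (in_slab k _ kc); rewrite /moved fk !inE eqxx ?orbT.
- by move=> /andP[kc fk]; apply: (in_slab k _ kc); rewrite /moved fk !inE eqxx ?orbT.
- by move=> /andP[kc fk]; apply: (in_slab k _ kc); rewrite /moved fk !inE eqxx ?orbT.
- by move=> /andP[kc fk]; apply: (in_slab k _ kc); rewrite /moved fk !inE eqxx ?orbT.
- by move=> jn; apply: (in_arc j _ jn); rewrite (closing_arcE jn) !inE eqxx ?orbT.
- by move=> jn; apply: (in_arc j _ jn); rewrite (closing_arcE jn) !inE eqxx ?orbT.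
- by move=> jn; apply: (in_arc j _ jn); rewrite (closing_arcE jn) !inE eqxx ?orbT.
- by move=> jn; apply: (in_arc j _ jn); rewrite (closing_arcE jn) !inE eqxx ?orbT.
- by move=> jn; apply: (in_arc j _ jn); rewrite (closing_arcE jn) !inE eqxx ?orbT.
Qed.

Lemma between_lt (t a b : R) : 0 <= t -> t < 1 -> a < b -> a <= a + t * (b - a) < b.
Proof. by move=> *; nra. Qed.

Lemma between_down_lt (t a b : R) :
  0 <= t -> t < 1 -> b < a -> b < a + t * (b - a) <= a.
Proof. by move=> *; nra. Qed.

(** A half-open edge with endpoints [p] and [q] contains [p] but not [q], so the
    strict inequality in a cell is on the side of [q]; the wrapped strands run
    round their rectangles against the direction of the closing arcs. *)
Lemma seg_cell d x y z : valid d ->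
  seg (named_edge d).1 (named_edge d).2 (pt x y z) ->
  pt x y z <> (named_edge d).2 -> cell d x y.
Proof.
have arc_bounds j : (j <= n)%N ->
    [/\ 0 <= (j%:R : R), j%:R <= n%:R :> R & 0 <= c%:R :> R].
  by move=> jn; rewrite !ler0n ler_nat.
have wrap_bounds k : (k < c)%N -> let r := radius (col k) in
    [/\ r < right r, bot r < top r, bot r < k%:R + 4^-1 & k%:R + 3 / 4 < top r].
  by move=> /slab_bounds[? ? ? ?]; rewrite /right /bot /top /radius; split; lra.
case: d => [k j|k|k|k|k|k|k|k|k|k|k|j|j|j|j|j] /= vd
  /seg_pt[t [t0 t1 xE yE zE]] ne;
  have {ne}t_1 : t < 1 by
    [rewrite lt_neqAle t1 andbT; apply/eqP => tE; apply: ne;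
     rewrite xE yE zE tE; congr pt; ring];
  clear zE.
- by split; lra.
- by split; lra.
- by split; lra.
- by split; lra.
- by rewrite /radius in xE; split; lra.
- have /wrap_bounds[_ _ h _] : (k < c)%N by case/andP: vd.
  by have := between_down_lt t0 t_1 h; rewrite -yE; split; lra.
- have /wrap_bounds[h _ _ _] : (k < c)%N by case/andP: vd.
  by have := between_lt t0 t_1 h; rewrite -xE; split; lra.
- have /wrap_bounds[_ h _ _] : (k < c)%N by case/andP: vd.
  by have := between_lt t0 t_1 h; rewrite -yE; split; lra.
- have /wrap_bounds[h _ _ _] : (k < c)%N by case/andP: vd.
  by have := between_down_lt t0 t_1 h; rewrite -xE; split; lra.
- have /wrap_bounds[_ _ _ h] : (k < c)%N by case/andP: vd.
  by have := between_down_lt t0 t_1 h; rewrite -yE; split; lra.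
- by rewrite /radius in xE; split; lra.
- have [j0 jn c0] := arc_bounds j vd.
  have h : c%:R < top j%:R by rewrite /top; lra.
  by have := between_lt t0 t_1 h; rewrite -yE; split; lra.
- have [j0 jn c0] := arc_bounds j vd.
  have h : j%:R < right j%:R by rewrite /right; lra.
  by have := between_lt t0 t_1 h; rewrite -xE; split; lra.
- have [j0 jn c0] := arc_bounds j vd.
  have h : bot j%:R < top j%:R by rewrite /top /bot; lra.
  by have := between_down_lt t0 t_1 h; rewrite -yE; split; lra.
- have [j0 jn c0] := arc_bounds j vd.
  have h : j%:R < right j%:R by rewrite /right; lra.
  by have := between_down_lt t0 t_1 h; rewrite -xE; split; lra.
- have [j0 jn c0] := arc_bounds j vd.
  have h : bot j%:R < 0 by rewrite /bot; lra.
  by have := between_lt t0 t_1 h; rewrite -yE; split; lra.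
Qed.

Definition in_slab k (d : name) : Prop :=
  match d with
  | Vert k' _ | Back k' | Bent1 k' | Bent2 k' | Wrap0 k' | Wrap6 k' => k' = k
  | _ => False
  end.

Definition on_loop (r : R) (d : name) : Prop :=
  match d with
  | Wrap1 k | Wrap2 k | Wrap3 k | Wrap4 k | Wrap5 k => radius (col k) = r
  | Arc0 j | Arc1 j | Arc2 j | Arc3 j | Arc4 j => j%:R = r
  | _ => False
  end.

Lemma slab_or_loop d : (exists k, in_slab k d) \/ (exists r, on_loop r d).
Proof.
by case: d => *; first [by left; eexists; reflexivity | by right; eexists; reflexivity].
Qed.

Lemma slab_cell k d x y : valid d -> in_slab k d -> cell d x y ->
  [/\ (k < c)%N, k%:R <= y < k%:R + 1 & 0 <= x <= n%:R].
Proof.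
case: d => [k' j|k'|k'|k'|k'|k'|k'|k'|k'|k'|k'|j|j|j|j|j] //= + <- [xE yb].
- move=> /and4P[kc jn _ _]; have j0 : 0 <= (j%:R : R) by [].
  have {}jn : j%:R <= n%:R :> R by rewrite ler_nat.
  by split=> //; lra.
- by move=> kc; have [? ? ? ?] := slab_bounds kc; split=> //; lra.
- by move=> /andP[kc _]; have [? ? ? ?] := slab_bounds kc; split=> //; lra.
- by move=> /andP[kc _]; have [? ? ? ?] := slab_bounds kc; split=> //; lra.
- by move=> /andP[kc _]; have [? ? ? ?] := slab_bounds kc; split=> //; lra.
- by move=> /andP[kc _]; have [? ? ? ?] := slab_bounds kc; split=> //; lra.
Qed.

Lemma loop_cell r d x y : valid d -> on_loop r d -> cell d x y ->
  0 <= r <= n%:R /\ on_rectangle r x y.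
Proof.
have wrap k : (k < c)%N && first k -> let r := radius (col k) in
    [/\ 0 <= r <= n%:R, r <= right r, bot r <= k%:R + 4^-1,
        k%:R + 3 / 4 <= top r & k%:R + 4^-1 <= top r /\ bot r <= k%:R + 3 / 4].
  move=> /andP[/slab_bounds[? ? ? ?] _].
  by rewrite /right /bot /top /radius; split; try split; lra.
have arc j : (j <= n)%N -> let r : R := j%:R in
    [/\ 0 <= r <= n%:R, r <= right r, bot r <= 0, c%:R <= top r &
        0 <= top r /\ bot r <= c%:R].
  move=> jn; have j0 : 0 <= (j%:R : R) by [].
  have {}jn : j%:R <= n%:R :> R by rewrite ler_nat.
  have c0 : 0 <= c%:R :> R by [].
  by rewrite /right /bot /top /=; split; try split; lra.
case: d => [k j|k|k|k|k|k|k|k|k|k|k|j|j|j|j|j] //=; move=> /[dup] vd;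
  first [move/wrap => + <- | move/arc => + <-];
  move=> [r0 r1 r2 r3 r4] [xE yb]; split=> //; rewrite /on_rectangle;
  first [ by left; split; [left | lra] | by left; split; [right | lra]
        | by right; split; [left | lra] | by right; split; [right | lra]].
Qed.

(** The rectangles are the level sets of
    [min x (2n + 1 - x) (c + n + 1 - y) (y + n + 1)]. *)
Lemma rectangle_inj r r' x y : 0 <= r <= n%:R -> 0 <= r' <= n%:R ->
  on_rectangle r x y -> on_rectangle r' x y -> r = r'.
Proof.
wlog lt_r : r r' / r < r' => [wl r0 r0' Hr Hr'|].
  have [lt|lt|//] := ltgtP r r'; first exact: wl.
  by apply/esym/wl.
have c0 : 0 <= c%:R :> R by [].
rewrite /on_rectangle /right /top /bot => r0 r0' Hr Hr'; exfalso.
by case: Hr => -[[] E b]; case: Hr' => -[[] E' b']; lra.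
Qed.

Definition crossing k (x y : R) : Prop :=
  [/\ (k < c)%N, ~~ first k, x = radius (col k) & y = k%:R + 2^-1].

(** All later letters of a column lie at larger [y] than its first one, so the
    wrapped strand passes their crossings between [top_left] and [entry]. *)
Definition over_crossing k (d : name) : Prop :=
  [\/ d = Back k, d = Bent2 k | d = Wrap5 (base (col k))].

Lemma slab_cells_meet k d d' x y : valid d -> valid d' ->
  in_slab k d -> in_slab k d' -> cell d x y -> cell d' x y ->
  d = d' \/ [/\ crossing k x y, over_crossing k d & over_crossing k d'].
Proof.
have gap j : valid (Vert k j) ->
    j%:R + 1 <= (col k)%:R :> R \/ (col k)%:R + 2 <= j%:R :> R.
  move=> /and4P[_ _ j1 j2]; have [/ltn_real|jk] := ltnP j (col k); first by left.
  have /ltn_real cj : ((col k).+1 < j)%N by lia.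
  by right; lra.
have vert_unique j d1 : valid (Vert k j) -> valid d1 -> in_slab k d1 ->
    cell (Vert k j) x y -> cell d1 x y -> Vert k j = d1.
  case: d1 => [k' j'|k'|k'|k'|k'|k'|k'|k'|k'|k'|k'|j'|j'|j'|j'|j'] //=
    /gap g _ -> [xE _] [xE' yE'].
  - by congr Vert; apply/eqP; rewrite -(eqr_nat R); apply/eqP; rewrite -xE -xE'.
  - by exfalso; case: g; lra.
  - by exfalso; case: g; lra.
  - by exfalso; case: g; lra.
  - by exfalso; case: g; lra.
  - by exfalso; case: g; lra.
have meet : cell (Back k) x y -> cell (Bent2 k) x y -> valid (Bent2 k) ->
    [/\ crossing k x y, over_crossing k (Back k) & over_crossing k (Bent2 k)].
  move=> /= [xE yE] [xE' yE'] /andP[kc fk].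
  by split; [split; rewrite // /radius; lra | constructor 1 | constructor 2].
case: d => [k1 j|k1|k1|k1|k1|k1|k1|k1|k1|k1|k1|j|j|j|j|j] // vd vd' e;
  rewrite /= in e; subst k1; move=> sd' cd cd';
  first by left; apply: vert_unique.
all: move: d' vd' sd' cd' => [k1 j|k1|k1|k1|k1|k1|k1|k1|k1|k1|k1|j|j|j|j|j] // vd' e;
  rewrite /= in e; subst k1; move=> cd'.
all: try by left.
all: try by left; apply/esym; apply: vert_unique.
all: try by exfalso; move: vd vd' => /andP[_ fk] /andP[_]; rewrite ?fk ?(negPf fk).
- by exfalso; move: cd cd' => /= [xE yE] [xE' yE']; lra.
- by right; apply: meet.
- by exfalso; move: cd cd' => /= [xE yE] [xE' yE']; lra.
- by exfalso; move: cd cd' => /= [xE yE] [xE' yE']; lra.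
- by exfalso; move: cd cd' => /= [xE yE] [xE' yE']; lra.
- by exfalso; move: cd cd' => /= [xE yE] [xE' yE']; lra.
- by right; have [] := meet cd' cd vd; split.
- by exfalso; move: cd cd' => /= [xE yE] [xE' yE']; lra.
- by exfalso; move: cd cd' => /= [xE yE] [xE' yE']; lra.
- by exfalso; move: cd cd' => /= [xE yE] [xE' yE']; lra.
- by exfalso; move: cd cd' => /= [xE yE] [xE' yE']; lra.
- by exfalso; move: cd cd' => /= [xE yE] [xE' yE']; lra.
Qed.

Lemma loop_cells_meet r d d' x y : valid d -> valid d' ->
  on_loop r d -> on_loop r d' -> cell d x y -> cell d' x y -> d = d'.
Proof.
have same_nat (i j : nat) : i%:R = j%:R :> R -> i = j.
  by move/eqP; rewrite eqr_nat => /eqP.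
have half (i j : nat) : radius i = j%:R -> False.
  by rewrite /radius; have [/ltn_real|] := ltnP i j; [|rewrite -(ler_nat R)]; lra.
have same_wrap k k' : (k < c)%N && first k -> (k' < c)%N && first k' ->
    radius (col k) = r -> radius (col k') = r -> k = k'.
  move=> /andP[_ /eqP fk] /andP[_ /eqP fk'] <- /addIr /same_nat E.
  by rewrite -fk -fk' E.
have wrap_dims k : (k < c)%N && first k -> let r := radius (col k) in
    [/\ r < right r, bot r < k%:R + 4^-1 & k%:R + 3 / 4 < top r].
  move=> /andP[/slab_bounds[? ? ? ?] _].
  by rewrite /right /bot /top /radius; split; lra.
have arc_dims j : (j <= n)%N -> let r : R := j%:R in
    [/\ r < right r, bot r < 0 & c%:R < top r].
  move=> jn; have {}jn : j%:R <= n%:R :> R by rewrite ler_nat.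
  by rewrite /right /bot /top; split; lra.
have c0 : 0 <= c%:R :> R by [].
case: d => [k j|k|k|k|k|k|k|k|k|k|k|j|j|j|j|j] //;
case: d' => [k' j'|k'|k'|k'|k'|k'|k'|k'|k'|k'|k'|j'|j'|j'|j'|j'] // vd vd' ld ld';
  rewrite /= in ld ld'.
all: try by exfalso; apply: half (etrans ld (esym ld')).
all: try by exfalso; apply: half (etrans ld' (esym ld)).
all: first [ have e := same_wrap _ _ vd vd' ld ld'
           | have e := same_nat _ _ (etrans ld (esym ld'))].
all: first [subst k' | subst j'].
all: try by [].
all: first [have [h1 h2 h3] := wrap_dims _ vd | have [h1 h2 h3] := arc_dims _ vd].
all: clear half same_nat same_wrap wrap_dims arc_dims vd vd' ld ld'.
all: by move=> /= [xE yE] [xE' yE']; exfalso; lra.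
Qed.

(** Over a slab the rectangles of radius at most [n] reduce to the vertical lines
    through their left sides, and the line between two positions is met only by
    the two strands that exchange these positions. *)
Lemma slab_loop_cells_meet k r d d' x y : valid d -> valid d' ->
  in_slab k d -> on_loop r d' -> cell d x y -> cell d' x y ->
  [/\ crossing k x y, over_crossing k d & over_crossing k d'].
Proof.
move=> vd vd' sd ld' cd cd'; have [kc yb xb] := slab_cell vd sd cd.
have [i0 iN k0 kC] := slab_bounds kc.
have arc_dims j : (j <= n)%N -> let r : R := j%:R in
    [/\ n%:R < right r, bot r < 0 & c%:R < top r].
  move=> jn; have {}jn : j%:R <= n%:R :> R by rewrite ler_nat.
  by rewrite /right /bot /top; split; lra.
have wrap_dims k' : (k' < c)%N && first k' -> let r := radius (col k') in
    [/\ n%:R < right r, bot r < 0 & c%:R < top r].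
  move=> /andP[/slab_bounds[? ? ? ?] _].
  by rewrite /right /bot /top /radius; split; lra.
have vertical k' : (k' < c)%N && first k' -> x = radius (col k') ->
    y <= k'%:R + 4^-1 \/ k'%:R + 3 / 4 < y ->
    [/\ crossing k x y, over_crossing k d, k' = base (col k) & k'%:R + 1 <= y].
  move=> /andP[k'c fk'] xE yE; clear vd' ld' cd' arc_dims wrap_dims.
  have not_vert : forall j, d <> Vert k j.
    move=> j dE; rewrite dE /= in cd; case: cd; rewrite xE /radius => xj _.
    have [/ltn_real|] := ltnP (col k') j; first by lra.
    by rewrite -(ler_nat R); lra.
  have colE : col k' = col k.
    have xi : (col k)%:R <= x <= (col k)%:R + 1.
      case: d {vd} sd cd not_vert => [k1 j|k1|k1|k1|k1|k1|k1|k1|k1|k1|k1|j|j|j|j|j] //=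
        -> [xE' yE'] nv; [by case: (nv j) | lra..].
    move: xi; rewrite xE /radius => xi.
    by have [/ltn_real lt|/ltn_real lt|//] := ltngtP (col k') (col k); exfalso; lra.
  have k'E : k' = base (col k) by rewrite -colE (eqP fk').
  have k'k : (k' <= k)%N by rewrite k'E base_le.
  rewrite colE /radius in xE.
  have [fk|fk] := boolP (first k).
    have k'_k : k' = k by rewrite k'E; apply/eqP.
    rewrite k'_k in yE; exfalso.
    case: d vd sd cd not_vert => [k1 j|k1|k1|k1|k1|k1|k1|k1|k1|k1|k1|j|j|j|j|j] //=
      + e; subst k1; rewrite ?fk ?andbF // => _ [xE' yE'] nv;
      [by case: (nv j) | case: yE => yE; lra..].
  have /ltn_real lt_k : (k' < k)%N.
    rewrite ltn_neqAle k'k andbT; apply: contra fk => /eqP kk.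
    by rewrite /first -k'E kk.
  suff [yE' od] : y = k%:R + 2^-1 /\ over_crossing k d by split=> //; lra.
  case: d vd sd cd not_vert => [k1 j|k1|k1|k1|k1|k1|k1|k1|k1|k1|k1|j|j|j|j|j] //=
    + e; subst k1; rewrite ?(negPf fk) ?andbF // => _ [xE' yE'] nv.
  - by case: (nv j).
  - by split; [lra | constructor 1].
  - by exfalso; lra.
  - by split; [lra | constructor 2].
case: d' vd' ld' cd' => [k' j|k'|k'|k'|k'|k'|k'|k'|k'|k'|k'|j|j|j|j|j] // vd' _ [xE yE].
- have [_ _ _] := vertical k' vd' xE (or_introl (andP yE).2); lra.
- by have [] := wrap_dims k' vd'; lra.
- by have [] := wrap_dims k' vd'; lra.
- by have [] := wrap_dims k' vd'; lra.
- have [cr od -> _] := vertical k' vd' xE (or_intror (andP yE).1).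
  by split=> //; constructor 3.
- by have [] := arc_dims j vd'; lra.
- by have [] := arc_dims j vd'; lra.
- by have [] := arc_dims j vd'; lra.
- by have [] := arc_dims j vd'; lra.
- by have [] := arc_dims j vd'; lra.
Qed.

(** The slabs are disjoint, and so are the rectangles; what remains is a slab
    against a rectangle. *)
Lemma cells_meet d d' x y : valid d -> valid d' -> cell d x y -> cell d' x y ->
  d = d' \/ exists k, [/\ crossing k x y, over_crossing k d & over_crossing k d'].
Proof.
move=> vd vd' cd cd'.
case: (slab_or_loop d) (slab_or_loop d') => -[k sd] [] [k' sd'].
- have [_ yb _] := slab_cell vd sd cd; have [_ yb' _] := slab_cell vd' sd' cd'.
  have kE : k' = k by have [/ltn_real lt|/ltn_real lt|//] := ltngtP k' k; exfalso; lra.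
  rewrite kE in sd'.
  by have [|] := slab_cells_meet vd vd' sd sd' cd cd'; [left | right; exists k].
- by right; exists k; apply: slab_loop_cells_meet sd' cd cd'.
- by right; exists k'; have [] := slab_loop_cells_meet vd' vd sd' sd cd' cd; split.
- have [r0 Hr] := loop_cell vd sd cd; have [r0' Hr'] := loop_cell vd' sd' cd'.
  rewrite (rectangle_inj r0' r0 Hr' Hr) in sd'.
  by left; apply: loop_cells_meet sd sd' cd cd'.
Qed.

(** * The wrapped diagram is a triple crossing projection *)

Lemma proj_pt (x y z x' y' z' : R) :
  proj (pt x y z) = proj (pt x' y' z') <-> x = x' /\ y = y'.
Proof.
split=> [/rowP e|[-> ->]]; first split.
- by have := e ord0; rewrite !mxE.
- by have := e (lift ord0 ord0); rewrite !mxE.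
- by apply/rowP => -[[|[|//]] lt_i]; rewrite /proj !mxE.
Qed.

Lemma proj_segment_inj (p q u v : 'rV[R]_3) : proj p <> proj q ->
  seg p q u -> seg p q v -> proj u = proj v -> u = v.
Proof.
move=> pq /segE[t [_ _ ->]] /segE[t' [_ _ ->]] e; suff -> : t = t' by [].
have : (t - t') *: (proj q - proj p) = 0.
  have /eqP := e; rewrite -subr_eq0 => /eqP <-.
  by apply/rowP => i; rewrite !mxE; ring.
move/eqP; rewrite scaler_eq0 !subr_eq0 => /orP[/eqP //|/eqP qp].
by case: pq; rewrite qp.
Qed.

Lemma proj_free (x y z x' y' z' : R) :
  (forall s t, s * x + t * x' = 0 -> s * y + t * y' = 0 -> s = 0 /\ t = 0) ->
  row_free (col_mx (proj (pt x y z)) (proj (pt x' y' z'))).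
Proof.
move=> ind; apply: inj_row_free => v.
rewrite -(hsubmxK v) mul_row_col (mx11_scalar (lsubmx v)) (mx11_scalar (rsubmx v)).
move: (lsubmx v 0 0) (rsubmx v 0 0) => s t; rewrite !mul_scalar_mx => /rowP e.
have := e ord0; have := e (lift ord0 ord0); rewrite !mxE /= => ey ex.
by have [-> ->] := ind _ _ ex ey; rewrite -(hsubmxK 0) !raddf0.
Qed.

Lemma named_edge_flat d : valid d ->
  proj (named_edge d).1 <> proj (named_edge d).2.
Proof.
have s1 := sgP.
have wrap k : (k < c)%N && first k -> let r := radius (col k) in
    [/\ r < right r, bot r < top r, bot r < k%:R + 4^-1 & k%:R + 3 / 4 < top r].
  move=> /andP[/slab_bounds[? ? ? ?] _].
  by rewrite /right /bot /top /radius; split; lra.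
have arc j : (j <= n)%N -> let r : R := j%:R in
    [/\ r < right r, bot r < top r, bot r < 0 & c%:R < top r].
  move=> jn; have {}jn : j%:R <= n%:R :> R by rewrite ler_nat.
  have c0 : 0 <= c%:R :> R by [].
  by rewrite /right /bot /top /=; split; lra.
case: d => [k j|k|k|k|k|k|k|k|k|k|k|j|j|j|j|j] vd /= /proj_pt[ex ey];
  try (by rewrite /radius in ex; lra);
  by first [have := wrap _ vd | have := arc _ vd]; rewrite /= => -[*]; lra.
Qed.

Lemma named_edge_neq d : valid d -> (named_edge d).1 <> (named_edge d).2.
Proof. by move=> /named_edge_flat ne e; apply: ne; rewrite e. Qed.

(** The strand arriving in position [j] at level [k] comes from slab [k - 1], or
    from closing arc [j] at level [0]. *)
Lemma predecessor_at k j : (k <= c)%N -> (j <= n)%N ->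
  exists2 d, valid d & (named_edge d).2 = pt j%:R k%:R 0.
Proof.
case: k => [_ jn|k kc jn]; first by exists (Arc4 j).
have [->|j1] := eqVneq j (col k); first by exists (Back k).
have [->|j2] := eqVneq j (col k).+1; last by exists (Vert k j); rewrite /= ?kc ?jn ?j1.
have [fk|fk] := boolP (first k); first by exists (Wrap6 k); rewrite //= kc.
by exists (Bent2 k); rewrite //= kc.
Qed.

Lemma predecessor d : valid d ->
  exists2 d', valid d' & (named_edge d').2 = (named_edge d).1.
Proof.
case: d => [k j|k|k|k|k|k|k|k|k|k|k|j|j|j|j|j] vd.
- by have /and4P[kc jn _ _] := vd; apply: predecessor_at => //; apply: ltnW.
- by apply: predecessor_at; [apply: ltnW | apply: col_lt].
- have /andP[kc _] := vd.
  by apply: predecessor_at; apply: ltnW => //; apply: col_lt.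
- by exists (Bent1 k).
- have /andP[kc _] := vd.
  by apply: predecessor_at; apply: ltnW => //; apply: col_lt.
- by exists (Wrap0 k).
- by exists (Wrap1 k).
- by exists (Wrap2 k).
- by exists (Wrap3 k).
- by exists (Wrap4 k).
- by exists (Wrap5 k).
- exact: predecessor_at.
- by exists (Arc0 j).
- by exists (Arc1 j).
- by exists (Arc2 j).
- by exists (Arc3 j).
Qed.

(** The three strands over a crossing, in an order that does not depend on the
    signs: the plane strand at height [0], the bent one at [1/3] or [-1/3], the
    wrapped one at [2] or [-2]. *)
Definition crossing_edge k (i : 'I_3) : name :=
  nth (Back k) [:: Back k; Bent2 k; Wrap5 (base (col k))] i.

Definition crossing_point k (i : 'I_3) : 'rV[R]_3 :=
  pt (radius (col k)) (k%:R + 2^-1) [:: 0; sg k / 3; 2 * sg (base (col k))]`_i.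

Lemma ord3P (i : 'I_3) (P : 'I_3 -> Prop) :
  P ord0 -> P (lift ord0 ord0) -> P (lift ord0 (lift ord0 ord0)) -> P i.
Proof.
case: i => [[|[|[|//]]] lt_i] p0 p1 p2.
- by rewrite (_ : Ordinal lt_i = ord0) //; apply: val_inj.
- by rewrite (_ : Ordinal lt_i = lift ord0 ord0) //; apply: val_inj.
- by rewrite (_ : Ordinal lt_i = lift ord0 (lift ord0 ord0)) //; apply: val_inj.
Qed.

Lemma over_crossing_edge k d : over_crossing k d -> exists i, d = crossing_edge k i.
Proof.
by case=> ->; [exists ord0 | exists (lift ord0 ord0) | exists (lift ord0 (lift ord0 ord0))].
Qed.

Lemma crossing_edge_valid k i : (k < c)%N -> ~~ first k -> valid (crossing_edge k i).
Proof.
move=> kc fk; elim/ord3P: i => //=; first by rewrite kc.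
by rewrite /first base_lt ?mem_col // col_base ?mem_col ?eqxx.
Qed.

Lemma base_before k : (k < c)%N -> ~~ first k -> (base (col k))%:R + 1 <= k%:R :> R.
Proof.
by move=> kc fk; apply: ltn_real; rewrite ltn_neqAle base_le // andbT.
Qed.

Lemma wrap5_range k : (k < c)%N -> ~~ first k ->
  let r := radius (col k) in
  (base (col k))%:R + 3 / 4 < k%:R + 2^-1 :> R /\ k%:R + 2^-1 < top r.
Proof.
move=> kc fk; have lt_k := base_before kc fk.
by have [? ? ? ?] := slab_bounds kc; rewrite /top /radius; split; lra.
Qed.

Lemma crossing_point_open k i : (k < c)%N -> ~~ first k ->
  open_seg (named_edge (crossing_edge k i)).1 (named_edge (crossing_edge k i)).2
    (crossing_point k i).
Proof.
move=> kc fk; elim/ord3P: i; rewrite /crossing_edge /crossing_point /=.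
- by exists 2^-1; split; [lra | lra |]; rewrite !ptZ ptD /radius; congr pt; lra.
- exists 3^-1; split; [lra | lra |].
  by rewrite /bend /finish !ptZ ptD /radius; congr pt; lra.
have [h1 h2] := wrap5_range kc fk.
rewrite /top_left /entry col_base ?mem_col //.
set r := radius (col k) in h2 *.
exists ((top r - (k%:R + 2^-1)) / (top r - ((base (col k))%:R + 3 / 4))); split.
- by rewrite divr_gt0 //; lra.
- by rewrite ltr_pdivrMr; lra.
- by rewrite !ptZ ptD; congr pt; field; lra.
Qed.

Lemma open_seg_seg (p q u : 'rV[R]_3) : open_seg p q u -> seg p q u.
Proof. by case=> t [/ltW t0 /ltW t1 uE]; exists t. Qed.

Lemma open_seg_start (p q : 'rV[R]_3) : open_seg p q p -> p = q.
Proof.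
case=> t [t0 _ e]; have /eqP : t *: (q - p) = 0.
  have <- : (1 - t) *: p + t *: q - p = 0 by rewrite -e subrr.
  by apply/rowP => i; rewrite !mxE; ring.
by rewrite scaler_eq0 gt_eqF //= subr_eq0 => /eqP.
Qed.

Lemma crossing_point_unique k i x y z : crossing k x y ->
  seg (named_edge (crossing_edge k i)).1 (named_edge (crossing_edge k i)).2 (pt x y z) ->
  pt x y z = crossing_point k i.
Proof.
move=> [kc fk -> ->] on_edge.
apply: proj_segment_inj on_edge (open_seg_seg (crossing_point_open i kc fk)) _.
  exact/named_edge_flat/crossing_edge_valid.
exact/proj_pt.
Qed.

Lemma crossing_point_inj k : injective (crossing_point k).
Proof.
move=> i j; move: (sgP k) (sgP (base (col k))) => s1 s2.
by elim/ord3P: i; elim/ord3P: j => // /pt_inj[_ _] /= e; exfalso;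
  case: s1 => s1; case: s2 => s2; rewrite ?s1 ?s2 in e; lra.
Qed.

Lemma crossing_transversal k i j : (k < c)%N -> ~~ first k -> i != j ->
  let e := named_edge (crossing_edge k i) in
  let f := named_edge (crossing_edge k j) in
  row_free (col_mx (proj (e.2 - e.1)) (proj (f.2 - f.1))).
Proof.
move=> kc fk; have [h1 h2] := wrap5_range kc fk.
have col_b : col (base (col k)) = col k by rewrite col_base ?mem_col.
have h : (base (col k))%:R + 3 / 4 < top (radius (col k)) by lra.
elim/ord3P: i; elim/ord3P: j => // _;
  rewrite /crossing_edge /= /bend /finish /top_left /entry ?col_b !ptB;
  apply: proj_free => s t ex ey.
- by split; lra.
- have s0 : s = 0 by lra.
  by split=> //; apply: (eq0_gap (or_intror h)); rewrite s0 in ey; lra.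
- by split; lra.
- have s0 : s = 0 by lra.
  by split=> //; apply: (eq0_gap (or_intror h)); rewrite s0 in ey; lra.
- have t0 : t = 0 by lra.
  by split=> //; apply: (eq0_gap (or_intror h)); rewrite t0 in ey; lra.
- have t0 : t = 0 by lra.
  by split=> //; apply: (eq0_gap (or_intror h)); rewrite t0 in ey; lra.
Qed.

(** Removing duplicates makes the list of edges duplicate-free at no cost: its
    body stays the same. *)
Definition final : seq (edge R) := undup (diagram predT).

Lemma finalP e : e \in final <-> exists2 d, valid d & e = named_edge d.
Proof. by rewrite mem_undup; apply: moved_diagramP. Qed.

(** Applied to two equal points, this shows that distinct edges can only share
    endpoints; applied to distinct ones, that singular points are crossings. *)
Lemma points_meet d d' x y z z' : valid d -> valid d' ->
  seg (named_edge d).1 (named_edge d).2 (pt x y z) -> pt x y z <> (named_edge d).2 ->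
  seg (named_edge d').1 (named_edge d').2 (pt x y z') -> pt x y z' <> (named_edge d').2 ->
  (d = d' /\ z = z') \/
  exists k i j, [/\ crossing k x y, d = crossing_edge k i, d' = crossing_edge k j,
                    pt x y z = crossing_point k i & pt x y z' = crossing_point k j].
Proof.
move=> vd vd' on ne on' ne'.
case: (cells_meet vd vd' (seg_cell vd on ne) (seg_cell vd' on' ne')) => [dd'|].
  left; split=> //; rewrite -dd' in on'.
  have /pt_inj[//] : pt x y z = pt x y z'.
  by apply: proj_segment_inj (named_edge_flat vd) on on' _; apply/proj_pt.
case=> k [cr /over_crossing_edge[i di] /over_crossing_edge[j dj]].
right; exists k, i, j; rewrite di in on; rewrite dj in on'.
by split=> //; apply: crossing_point_unique.
Qed.

Lemma final_starts_uniq : {in final &, injective (fst : edge R -> 'rV[R]_3)}.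
Proof.
move=> _ _ /finalP[d vd ->] /finalP[d' vd' ->] e.
have [x [y [z pE]]] := pt_surj (named_edge d).1.
have := segl (named_edge d).1 (named_edge d).2; rewrite {2}pE => on.
have := segl (named_edge d').1 (named_edge d').2; rewrite -{2}e {1}pE => on'.
have ne := named_edge_neq vd; have ne' := named_edge_neq vd'.
rewrite -e in ne'.
have := points_meet vd vd' on _ on' _; rewrite -pE => /(_ ne ne')[[-> //]|].
case=> k [i [j [[kc fk _ _] dE _ pE' _]]].
have := crossing_point_open i kc fk; rewrite -pE' -dE => /open_seg_start.
by move=> /ne.
Qed.

(** Every start is an end, starts are distinct and both lists are equally long,
    so the ends are distinct as well. *)
Lemma final_starts_ends : perm_eq (unzip1 final) (unzip2 final).
Proof.
have u1 : uniq (unzip1 final).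
  by rewrite map_inj_in_uniq ?undup_uniq //; apply: final_starts_uniq.
have sub : {subset unzip1 final <= unzip2 final}.
  move=> _ /mapP[_ /finalP[d vd ->] ->]; have [d' vd' <-] := predecessor vd.
  by apply/mapP; exists (named_edge d') => //; apply/finalP; exists d'.
have sz : (size (unzip2 final) <= size (unzip1 final))%N by rewrite !size_map.
have [_ eq_mem] := uniq_min_size u1 sub sz.
exact: uniq_perm u1 (leq_size_uniq u1 sub sz) eq_mem.
Qed.

(** The end of an edge is the start of the next one, so the half-open edges
    still cover the link. *)
Lemma final_half_open p : body final p ->
  exists d, [/\ valid d, seg (named_edge d).1 (named_edge d).2 p &
                p <> (named_edge d).2].
Proof.
case=> _ /finalP[d vd ->] on.
have [pE|ne] := pselect (p = (named_edge d).2); last by exists d.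
have : p \in unzip1 final.
  rewrite (perm_mem final_starts_ends); apply/mapP; exists (named_edge d) => //.
  by apply/finalP; exists d.
case/mapP => _ /finalP[d' vd' ->] ->; exists d'; split=> //; first exact: segl.
exact: named_edge_neq.
Qed.

Lemma uniq_map_inj (T U : eqType) (f : T -> U) (s : seq T) :
  uniq (map f s) -> {in s &, injective f}.
Proof.
elim: s => //= a s IHs /andP[fa us] u v; rewrite !inE.
case/predU1P => [->|us']; case/predU1P => [->|vs'] // e.
- by rewrite e map_f in fa.
- by rewrite -e map_f in fa.
- exact: IHs.
Qed.

Lemma final_link_edges : link_edges final.
Proof.
split.
- have : named_edge (Arc0 0) \in final by apply/finalP; exists (Arc0 0).
  by case: final.
- by move=> _ /finalP[d vd ->]; apply/eqP/named_edge_neq.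
- by rewrite map_inj_in_uniq ?undup_uniq //; apply: final_starts_uniq.
- exact: final_starts_ends.
have u2 : {in final &, injective (snd : edge R -> 'rV[R]_3)}.
  apply: uniq_map_inj; rewrite -(perm_uniq final_starts_ends).
  by rewrite map_inj_in_uniq ?undup_uniq //; apply: final_starts_uniq.
have joint d d' : valid d -> valid d' -> named_edge d != named_edge d' ->
    seg (named_edge d').1 (named_edge d').2 (named_edge d).2 ->
    (named_edge d).2 = (named_edge d').1.
  move=> vd vd' nee on'.
  have dK : named_edge d \in final by apply/finalP; exists d.
  have d'K : named_edge d' \in final by apply/finalP; exists d'.
  have : (named_edge d).2 \in unzip1 final.
    by rewrite (perm_mem final_starts_ends); apply/mapP; exists (named_edge d).
  case/mapP => _ /finalP[d2 vd2 ->] e2.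
  have ne' : (named_edge d).2 <> (named_edge d').2.
    by move/(u2 _ _ dK d'K) => e; rewrite e eqxx in nee.
  have ne2 : (named_edge d).2 <> (named_edge d2).2.
    by rewrite e2; apply: named_edge_neq.
  have on2 : seg (named_edge d2).1 (named_edge d2).2 (named_edge d).2.
    by rewrite e2; apply: segl.
  have [x [y [z pE]]] := pt_surj (named_edge d).2.
  rewrite pE in on' on2 ne' ne2 e2 *.
  have [[<- //]|] := points_meet vd2 vd' on2 ne2 on' ne'.
  case=> k [i [j [[kc fk _ _] dE _ pE' _]]].
  have := crossing_point_open i kc fk; rewrite -pE' -dE e2 => /open_seg_start.
  by move/named_edge_neq: vd2 => ne /ne.
move=> _ _ /finalP[d vd ->] /finalP[d' vd' ->] nee p on on'.
have [pE|ne] := pselect (p = (named_edge d).2).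
  by left; split=> //; rewrite pE; apply: joint; rewrite -?pE.
have [pE|ne'] := pselect (p = (named_edge d').2).
  by right; split=> //; rewrite pE; apply: joint; rewrite -?pE // eq_sym.
exfalso; have [x [y [z E]]] := pt_surj p; rewrite {}E in on on' ne ne'.
have [[e _]|] := points_meet vd vd' on ne on' ne'; first by rewrite e eqxx in nee.
case=> k [i [j [_ dE dE' -> /crossing_point_inj e]]].
by rewrite dE dE' e eqxx in nee.
Qed.

Lemma final_singular_points q : singular_points final q ->
  exists k, [/\ (k < c)%N, ~~ first k & q = proj (crossing_point k ord0)].
Proof.
case=> u [v [bu bv uv <- e]].
have [d [vd on ne]] := final_half_open bu.
have [d' [vd' on' ne']] := final_half_open bv.
have [x [y [z uE]]] := pt_surj u; have [x' [y' [z' vE]]] := pt_surj v.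
move: e uv on ne on' ne'; rewrite {}uE {}vE => /proj_pt[-> ->] uv on ne on' ne'.
have [[_ zz]|] := points_meet vd vd' on ne on' ne'; first by rewrite zz eqxx in uv.
by case=> k [i [j [[kc fk -> ->] _ _ _ _]]]; exists k; split=> //; apply/proj_pt.
Qed.

Lemma final_triple_crossing : triple_crossing_projection final.
Proof.
move=> q /final_singular_points[k [kc fk ->]].
exists (fun i => named_edge (crossing_edge k i)), (crossing_point k); split.
- by move=> i; apply/finalP; exists (crossing_edge k i) => //; apply: crossing_edge_valid.
- by move=> i; apply: crossing_point_open.
- exact: crossing_point_inj.
- apply/predeqP => u; split=> [[bu /= uq]|[i _ <-]]; last first.
    split; last by apply/proj_pt.
    exists (named_edge (crossing_edge k i)).
      by apply/finalP; exists (crossing_edge k i) => //; apply: crossing_edge_valid.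
    exact/open_seg_seg/crossing_point_open.
  have [d [vd on ne]] := final_half_open bu.
  have [x [y [z uE]]] := pt_surj u; rewrite {}uE in uq on ne *.
  have /proj_pt[xE yE] := uq; rewrite {}xE {}yE in on ne *.
  have oc := crossing_point_open ord0 kc fk.
  have v0 := crossing_edge_valid ord0 kc fk.
  have cr : crossing k (radius (col k)) (k%:R + 2^-1) by [].
  have back : cell (Back k) (radius (col k)) (k%:R + 2^-1).
    by rewrite /= /radius; split; lra.
  have [dE|[k' [cr' _ /over_crossing_edge[i dE]]]] :=
      cells_meet (v0 : valid (Back k)) vd back (seg_cell vd on ne).
    rewrite -dE in on; exists ord0 => //.
    by apply/esym; apply: (@crossing_point_unique k ord0).
  have k'k : k' = k.
    case: cr' => _ _ _ kk'; apply/eqP; rewrite -(eqr_nat R); apply/eqP; lra.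
  rewrite k'k in dE; rewrite dE in on.
  by exists i => //; apply/esym; apply: crossing_point_unique on.
- by move=> i j ij; apply: crossing_transversal.
Qed.

Lemma mem_cols i : connected_word w -> (i < n)%N -> i \in cols.
Proof.
move=> w_connected lt_i; have /mapP[l lw lE] := w_connected (Ordinal lt_i).
by apply/mapP; exists l; rewrite // -lE.
Qed.

Definition crossings : seq nat := [seq k <- iota 0 c | ~~ first k].

(** Every column has a first letter, and first letters of different columns are
    different. *)
Lemma size_crossings : connected_word w -> (size crossings + n <= c)%N.
Proof.
move=> /mem_cols mem_w.
have -> : c = (size crossings + size [seq k <- iota 0 c | first k])%N.
  by rewrite !size_filter addnC count_predC size_iota.
rewrite leq_add2l -{1}(size_iota 0 n) -(size_map base); apply: uniq_leq_size.
  rewrite map_inj_in_uniq ?iota_uniq // => i j; rewrite !mem_iota /= !add0n.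
  by move=> /mem_w ic /mem_w jc e; rewrite -(col_base ic) e col_base.
move=> _ /mapP[i + ->]; rewrite mem_iota add0n => /mem_w ic.
by rewrite mem_filter mem_iota add0n base_lt // /first col_base ?eqxx.
Qed.

Lemma card_singular_points :
  exists2 m, (m <= size crossings)%N & (singular_points final #= `I_m)%card.
Proof.
pose f m : 'rV[R]_2 := proj (crossing_point (nth 0%N crossings m) ord0).
have le_sing : (singular_points final #<= `I_(size crossings))%card.
  apply: card_le_trans (card_image_le f _); apply: subset_card_le => q.
  move=> /final_singular_points[k [kc fk ->]].
  have kin : k \in crossings by rewrite mem_filter fk mem_iota.
  by exists (index k crossings); rewrite /= ?index_mem // /f nth_index.
have : finite_set (singular_points final).
  by apply: card_le_finite le_sing _; apply: finite_II.
move/finite_setP => [m sm]; exists m => //.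
by rewrite -card_le_II -(card_le_eql sm).
Qed.

Lemma closure_triple_crossings (L : set 'rV[R]_3) :
  is_closure w L -> connected_word w -> triple_crossings_at_most L (braid_bound w).
Proof.
move=> wL w_connected; have [m le_m card_m] := card_singular_points; exists m.
  exists final; split=> //; first exact: final_link_edges.
    rewrite /final (body_eq_mem (mem_undup _)).
    exact: link_equiv_trans (link_equiv_sym wL) closed_braid_moved.
  exact: final_triple_crossing.
by have := size_crossings w_connected; rewrite /braid_bound; lia.
Qed.

End Diagram.

Theorem theorem2p2 (R : realType) (L : set 'rV[R]_3) (hL : polygonal_link L) :
  (forall (n : nat) (w : braid_word n),
     is_closure w L -> connected_word w ->
     triple_crossings_at_most L (braid_bound w))
  /\
  ((exists (n : nat) (w : braid_word n), is_closure w L /\ connected_word w) ->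
   exists (n : nat) (w : braid_word n),
     [/\ is_closure w L, connected_word w,
         forall (n' : nat) (w' : braid_word n'),
           is_closure w' L -> connected_word w' -> braid_bound w <= braid_bound w'
       & triple_crossings_at_most L (braid_bound w)]).
Proof.
split=> [n w|[n [w [wL w_connected]]]]; first exact: closure_triple_crossings.
pose attained m := `[< exists n (w : braid_word n),
  [/\ is_closure w L, connected_word w & braid_bound w = m%:Z] >].
have bound_nat n' (w' : braid_word n') : is_closure w' L -> connected_word w' ->
    exists2 m, attained m & braid_bound w' = m%:Z.
  move=> w'L w'_connected.
  have [k _ le_k] := closure_triple_crossings w'L w'_connected.
  have boundE : braid_bound w' = `|braid_bound w'|%N by lia.
  by exists `|braid_bound w'|%N => //; apply/asboolP; exists n', w'.
have some_bound : exists m, attained m.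
  by have [m] := bound_nat n w wL w_connected; exists m.
have [m /asboolP[n0 [w0 [w0L w0_connected w0E]]] m_min] := ex_minnP some_bound.
exists n0, w0; split=> //; last exact: closure_triple_crossings.
move=> n' w' w'L w'_connected; rewrite w0E.
have [m' /m_min le_m ->] := bound_nat n' w' w'L w'_connected.
by rewrite lez_nat.
Qed.
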